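(* Consider the series whose $N$-th partial sum is $$G_N^0(x,\alpha,\theta)=\frac{1}{\pi\alpha}\sum_{n=0}^{N-1}\frac{x^{n+1}}{(n+1)!}\,\Gamma\left(\frac{n+1}{\alpha}\right)\sin\left(\tfrac{\pi}{2}(n+1)(1-\theta)\right).$$ (1) In the case $\alpha<1$ this series diverges for all $x$ as $N\to\infty$. In this case, for any admissible $\theta$, the distribution function $G(x,\alpha,\theta)$ of the standard strictly stable law has the asymptotic expansion $$G(x,\alpha,\theta)\sim\frac{1-\theta}{2}+\frac{1}{\pi\alpha}\sum_{n=0}^{N-1}\frac{x^{n+1}}{(n+1)!}\,\Gamma\left(\frac{n+1}{\alpha}\right)\sin\left(\tfrac{\pi}{2}(n+1)(1-\theta)\right),\quad x\to0.$$ (2) In the case $\alpha=1$ the series converges for $|x|<1$. In this case, for any admissible $\theta\neq\pm1$ and $|x|<1$, the distribution function is represented by the infinite series $$G(x,1,\theta)=\frac{1-\theta}{2}+\frac{1}{\pi}\sum_{n=0}^{\infty}\frac{x^{n+1}}{n+1}\sin\left(\tfrac{\pi}{2}(n+1)(1-\theta)\right).$$ (3) In the case $\alpha>1$ the series converges for any $x$ as $N\to\infty$. In this case, for any admissible $\theta$, the distribution function is represented by the infinite power series $$G(x,\alpha,\theta)=\frac{1-\theta}{2}+\frac{1}{\pi\alpha}\sum_{n=0}^{\infty}\frac{x^{n+1}}{(n+1)!}\,\Gamma\left(\frac{n+1}{\alpha}\right)\sin\left(\tfrac{\pi}{2}(n+1)(1-\theta)\right).$$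
   Context: The standard strictly stable law with parameters $(\alpha,\theta)$ (parameterization ''C'', scale $\lambda=1$) is the probability law on $\mathbf{R}$ with characteristic function $$\hat g(t,\alpha,\theta)=\exp\left\{-|t|^\alpha\exp\{-i\tfrac{\pi}{2}\alpha\theta\,\mathrm{sign}\,t\}\right\},\quad t\in\mathbf{R}.$$ The parameters are called admissible if $\alpha\in(0,2]$ and $|\theta|\leqslant\min(1,2/\alpha-1)$. Its probability density is $g(x,\alpha,\theta)=\frac{1}{2\pi}\int_{-\infty}^{\infty}e^{-itx}\hat g(t,\alpha,\theta)\,dt$ and its distribution function is $G(x,\alpha,\theta)=\int_{-\infty}^{x}g(\xi,\alpha,\theta)\,d\xi$. Here $x$ is real and $\Gamma$ is the Euler gamma function. The relation $\sim$, $x\to0$, is meant in the sense of asymptotic series: for every fixed $N$, $G(x,\alpha,\theta)=\frac{1-\theta}{2}+G_N^0(x,\alpha,\theta)+O(x^{N+1})$ as $x\to0$.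
   Formalization: In (1), divergence of the series is stated only for x ≠ 0 and admissible θ ≠ ±1, since at x = 0 or θ = ±1 every term of the series is zero and it converges; the asymptotic expansion is still stated for all admissible θ. *)

(* Defs.v *)
From HB Require Import structures.
From mathcomp Require Import all_boot all_order all_algebra.
From mathcomp Require Import complex.
From mathcomp Require Import all_classical all_reals all_analysis.

Set Implicit Arguments.
Unset Strict Implicit.
Unset Printing Implicit Defensive.

Import Order.TTheory GRing.Theory Num.Theory.
Import numFieldNormedType.Exports.

Local Open Scope classical_set_scope.
Local Open Scope ring_scope.
Local Open Scope complex_scope.

Section StableLaw.
Context {R : realType}.
Implicit Types (s t x alpha theta : R).

Definition cexp (z : R[i]) : R[i] :=
  (expR (complex.Re z) * cos (complex.Im z)) +i*
  (expR (complex.Re z) * sin (complex.Im z)).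

Definition cintegral (f : R -> R[i]) : R[i] :=
  (\int[lebesgue_measure]_(t in [set: R]) complex.Re (f t)) +i*
  (\int[lebesgue_measure]_(t in [set: R]) complex.Im (f t)).

(* The integral converges, and so is meaningful, only for 0 < s. *)
Definition Gamma s : R :=
  \int[lebesgue_measure]_(t in `]0, +oo[) (t `^ (s - 1) * expR (- t)).

Definition admissible alpha theta : Prop :=
  (0 < alpha <= 2) /\ `|theta| <= Num.min 1 (2 / alpha - 1).

Definition stable_charfun alpha theta t : R[i] :=
  cexp (- ((`|t| `^ alpha)%:C *
           cexp (- 'i%C * (pi / 2 * alpha * theta * Num.sg t)%:C))).

(* By the Hermitian symmetry of the characteristic function the inversion
   integral is real; Re only performs the cast from R[i] to R. The integral
   converges absolutely for admissible parameters, except for alpha = 1 and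
   theta = 1 or -1, where the law is a point mass without density. *)
Definition stable_density alpha theta x : R :=
  complex.Re ((2 * pi)^-1%:C *
    cintegral (fun t => cexp (- 'i%C * (t * x)%:C) * stable_charfun alpha theta t)).

Definition stable_cdf alpha theta x : R :=
  \int[lebesgue_measure]_(xi in `]-oo, x]) stable_density alpha theta xi.

Definition stable_series alpha theta x (N : nat) : R :=
  1 / (pi * alpha) * \sum_(0 <= n < N)
    x ^+ n.+1 / (n.+1)`!%:R * Gamma (n.+1%:R / alpha)
    * sin (pi / 2 * n.+1%:R * (1 - theta)).

End StableLaw.

(* Main.v *)
Require Import Defs.
From HB Require Import structures.
From mathcomp Require Import all_boot all_order all_algebra.
From mathcomp Require Import ring lra complex.
From mathcomp Require Import all_classical all_reals all_analysis measurable_realfun.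

(* Write [psi = pi / 2 * alpha * theta]. Rotating the half-line of integration
   of [z ^ (p - 1) * exp (i * X * z - lam * exp (- i * psi) * z ^ alpha)] does not
   change the integral when [0 < p]: differentiated in the angle, the integrand
   is an exact derivative along the ray. For [p = 0] the boundary term at the
   origin makes the integral grow linearly in the angle. With [X = 0], rotating
   to the axis on which the exponent is real turns the moments of the
   characteristic function on the half-line into Gamma values.
   A small rotation with [X > 0] gives the decay of the density at the left end
   and the limit of [M Y = int t^-1 exp (- t ^ alpha * cos psi) *
   sin (Y t + t ^ alpha * sin psi) dt] at [+oo], whence the inversion formula
   [G x = 1 / 2 - M (- x) / pi] by the fundamental theorem of calculus. Taylor's
   formula for the sine then bounds [G x - (1 - theta) / 2 - G_N x] by
   [|x| ^ (N + 1) / (N + 1)! / pi * int t ^ N exp (- t ^ alpha * cos psi) dt], which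
   is (1), and tends to 0 when [1 < alpha]. For [alpha = 1] the density is
   explicit and its Taylor polynomials are geometric sums. For [alpha < 1] the
   coefficients without the sine factor grow, while [sin (n * beta)] tends to 0
   only if [sin beta = 0], so the terms of the series do not tend to 0. *)

Set Implicit Arguments.
Unset Strict Implicit.
Unset Printing Implicit Defensive.

Import Order.TTheory GRing.Theory Num.Theory.
Import numFieldNormedType.Exports.

Local Open Scope classical_set_scope.
Local Open Scope ring_scope.

(** * Differentiation rules for real functions *)

Section derive_rules.
Context {R : realType}.
Implicit Types (f g : R -> R) (x a b c : R).

(* An alias hiding the class [is_derive], so that applying the rules below does
   not start an instance search. *)
Definition has_derive f x a : Prop := is_derive x 1 f a.

Lemma has_derive_eq f x a b : has_derive f x a -> a = b -> has_derive f x b.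
Proof. by move=> df <-. Qed.

Lemma has_derive_cst x c : has_derive (fun=> c) x 0.
Proof. exact: is_derive_cst. Qed.

Lemma has_derive_id x : has_derive (fun t => t) x 1.
Proof. exact: is_derive_id. Qed.

Lemma has_deriveN f x a : has_derive f x a -> has_derive (fun t => - f t) x (- a).
Proof. exact: is_deriveN. Qed.

Lemma has_deriveD f g x a b : has_derive f x a -> has_derive g x b ->
  has_derive (fun t => f t + g t) x (a + b).
Proof. exact: is_deriveD. Qed.

Lemma has_deriveM f g x a b : has_derive f x a -> has_derive g x b ->
  has_derive (fun t => f t * g t) x (f x * b + g x * a).
Proof. exact: is_deriveM. Qed.

Lemma has_deriveV f x a : f x != 0 -> has_derive f x a ->
  has_derive (fun t => (f t)^-1) x (- (f x) ^- 2 * a).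
Proof. exact: is_deriveV. Qed.

Lemma has_derive_comp f g x a b : has_derive f (g x) a -> has_derive g x b ->
  has_derive (fun t => f (g t)) x (a * b).
Proof. exact: is_derive1_comp. Qed.

Lemma has_derive_expR f x a : has_derive f x a ->
  has_derive (fun t => expR (f t)) x (expR (f x) * a).
Proof. apply: has_derive_comp; exact: is_derive_expR. Qed.

Lemma has_derive_sin f x a : has_derive f x a ->
  has_derive (fun t => sin (f t)) x (cos (f x) * a).
Proof. apply: has_derive_comp; exact: is_derive_sin. Qed.

Lemma has_derive_cos f x a : has_derive f x a ->
  has_derive (fun t => cos (f t)) x (- sin (f x) * a).
Proof. apply: has_derive_comp; exact: is_derive_cos. Qed.

Lemma has_derive_powR f x a p : 0 < f x -> has_derive f x a ->
  has_derive (fun t => f t `^ p) x (p * f x `^ (p - 1) * a).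
Proof.
by move=> fx0; apply: (@has_derive_comp (fun t => t `^ p)); exact: is_derive1_powR.
Qed.

Lemma has_deriveX f x a n : has_derive f x a ->
  has_derive (fun t => f t ^+ n.+1) x (n.+1%:R * f x ^+ n * a).
Proof.
move=> df; elim: n => [|n IHn].
  by rewrite expr0 !mul1r; under eq_fun do rewrite expr1.
under eq_fun do rewrite exprS; apply: has_derive_eq.
  exact: (@has_deriveM f (fun t => f t ^+ n.+1) _ _ _ df IHn).
by rewrite !exprS -[in RHS]natr1; ring.
Qed.

Lemma has_derive_continuous f x a : has_derive f x a -> {for x, continuous f}.
Proof.
by move=> [df _]; apply: differentiable_continuous; exact/derivable1_diffP.
Qed.

Lemma has_derive1E f x a : has_derive f x a -> derive1 f x = a.
Proof. by move=> df; rewrite derive1E; exact: derive_val. Qed.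

End derive_rules.

(** Builds the derivative along the syntax of the function, starting from an existential variable;
    positivity of the base of a power and nonvanishing of an inverted function remain as goals.
    After [has_derive_continuous] it serves as a proof of continuity. *)
Ltac der := lazymatch goal with
  | |- has_derive (fun _ => ?c) _ _ => exact: has_derive_cst
  | |- has_derive (fun t => t) _ _ => exact: has_derive_id
  | |- has_derive (fun t => - @?f t) _ _ => refine (@has_deriveN _ f _ _ _); der
  | |- has_derive (fun t => @?f t + @?g t) _ _ =>
      refine (@has_deriveD _ f g _ _ _ _ _); der
  | |- has_derive (fun t => @?f t * @?g t) _ _ =>
      refine (@has_deriveM _ f g _ _ _ _ _); der
  | |- has_derive (fun t => expR (@?f t)) _ _ => refine (@has_derive_expR _ f _ _ _); der
  | |- has_derive (fun t => sin (@?f t)) _ _ => refine (@has_derive_sin _ f _ _ _); der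
  | |- has_derive (fun t => cos (@?f t)) _ _ => refine (@has_derive_cos _ f _ _ _); der
  | |- has_derive (fun t => @?f t `^ ?p) _ _ => refine (@has_derive_powR _ f _ _ p _ _); der
  | |- has_derive (fun t => (@?f t)^-1) _ _ => refine (@has_deriveV _ f _ _ _ _); der
  | |- has_derive (fun t => @?f t ^+ ?n.+1) _ _ => refine (@has_deriveX _ f _ _ n _); der
  | |- _ => idtac
  end.

(** * Integration on half-lines *)

Section integration.
Context {R : realType}.
Local Notation mu := (@lebesgue_measure R).
Implicit Types (f g F : R -> R) (D : set R).

Lemma integrable_dominated D f g : measurable D -> measurable_fun D f ->
  (forall x : R, D x -> `|f x| <= g x) -> mu.-integrable D (EFin \o g) ->
  mu.-integrable D (EFin \o f).
Proof.
move=> mD mf fg ig; apply: (@le_integrable _ _ _ mu D mD _ (EFin \o g)) => //.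
  exact/measurable_EFinP.
move=> x Dx /=; rewrite lee_fin.
by rewrite (le_trans (fg _ Dx))// ler_norm.
Qed.

Lemma integrable_scale D f k : measurable D -> mu.-integrable D (EFin \o f) ->
  mu.-integrable D (EFin \o (fun x => k * f x)).
Proof. by move=> mD intf; exact: (@integrableZl _ _ _ mu D mD k (EFin \o f) intf). Qed.

Lemma integrable_add D f g : measurable D -> mu.-integrable D (EFin \o f) ->
  mu.-integrable D (EFin \o g) -> mu.-integrable D (EFin \o (fun x => f x + g x)).
Proof. by move=> mD intf intg; exact: (@integrableD _ _ _ mu D mD (EFin \o f) (EFin \o g) intf intg). Qed.

Lemma integrable_sub D f g : measurable D -> mu.-integrable D (EFin \o f) ->
  mu.-integrable D (EFin \o g) -> mu.-integrable D (EFin \o (fun x => f x - g x)).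
Proof. by move=> mD intf intg; exact: (@integrableB _ _ _ mu D mD (EFin \o f) (EFin \o g) intf intg). Qed.

Lemma integrable_setU A B f : measurable A -> measurable B ->
  mu.-integrable A (EFin \o f) -> mu.-integrable B (EFin \o f) ->
  mu.-integrable (A `|` B) (EFin \o f).
Proof.
move=> mA mB intA intB.
have -> : A `|` B = A `|` (B `\` A).
  apply/seteqP; split=> x /= [Ax|]; [by left| |by left|by case; right].
  by move=> Bx; have [Ax|nAx] := pselect (A x); [left|right].
have mBA : measurable (B `\` A) by exact: measurableD.
have intBA : mu.-integrable (B `\` A) (EFin \o f).
  by apply: (@integrableS _ _ _ mu _ _ _ mB mBA _ intB); exact: subDsetl.
have mU : measurable_fun (A `|` (B `\` A) : set (measurableTypeR R)) (EFin \o f).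
  apply/(measurable_funU _ mA mBA); split.
    exact: measurable_int intA.
  exact: measurable_int intBA.
apply/integrableP; split=> //.
rewrite ge0_integral_setU//=.
- by apply: lte_add_pinfty; [case/integrableP: intA|case/integrableP: intBA].
- by apply/measurable_EFinP; apply: measurableT_comp => //; exact/measurable_EFinP.
- by apply/disj_setPS => x /= [Ax []].
Qed.

Lemma integrable_eq_pos f g : (forall x : R, 0 < x -> f x = g x) ->
  mu.-integrable `]0, +oo[ (EFin \o f) -> mu.-integrable `]0, +oo[ (EFin \o g).
Proof.
move=> fg; apply: eq_integrable => //= x.
by rewrite inE/= in_itv/= andbT => /fg ->.
Qed.

Lemma Rintegral_eq_pos f g : (forall x : R, 0 < x -> f x = g x) ->
  \int[mu]_(x in `]0, +oo[) f x = \int[mu]_(x in `]0, +oo[) g x.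
Proof.
move=> fg; apply: eq_Rintegral => x.
by rewrite inE/= in_itv/= andbT => /fg ->.
Qed.

(* Continuity on the open half-line replaces a measurability hypothesis. *)
Lemma integrable_pos_dominated f g : (forall x : R, 0 < x -> {for x, continuous f}) ->
  (forall x : R, 0 < x -> `|f x| <= g x) -> mu.-integrable `]0, +oo[ (EFin \o g) ->
  mu.-integrable `]0, +oo[ (EFin \o f).
Proof.
move=> cf fg; apply: integrable_dominated => //.
- apply: open_continuous_measurable_fun; first exact: interval_open.
  by move=> x /[!inE]/=; rewrite in_itv/= andbT; exact: cf.
- by move=> x /=; rewrite in_itv/= andbT; exact: fg.
Qed.

Lemma le_Rintegral_pos f g : mu.-integrable `]0, +oo[ (EFin \o f) ->
  mu.-integrable `]0, +oo[ (EFin \o g) -> (forall x : R, 0 < x -> f x <= g x) ->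
  \int[mu]_(x in `]0, +oo[) f x <= \int[mu]_(x in `]0, +oo[) g x.
Proof.
move=> intf intg fg; apply: le_Rintegral => // x /=.
by rewrite in_itv/= andbT; exact: fg.
Qed.

Lemma norm_Rintegral_pos_le f g : mu.-integrable `]0, +oo[ (EFin \o f) ->
  mu.-integrable `]0, +oo[ (EFin \o g) -> (forall x : R, 0 < x -> `|f x| <= g x) ->
  `|\int[mu]_(x in `]0, +oo[) f x| <= \int[mu]_(x in `]0, +oo[) g x.
Proof.
move=> intf intg fg.
have mI : measurable (`]0, +oo[%classic : set (measurableTypeR R)) by exact: measurable_itv.
rewrite (le_trans (le_normr_Rintegral mI intf))//.
by apply: le_Rintegral_pos => //; exact: integrable_norm.
Qed.

(** Dominated convergence for the restrictions of [f] to the sets [E n], with [|f|] as majorant. *)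
Lemma cvg_Rintegral_exhaustion (E : (set R)^nat) f :
  nondecreasing_seq E -> (forall n, measurable (E n)) ->
  mu.-integrable (\bigcup_n E n) (EFin \o f) ->
  \int[mu]_(x in E n) f x @[n --> \oo] --> \int[mu]_(x in \bigcup_n E n) f x.
Proof.
move=> ndE mE intf.
have mU : measurable (\bigcup_n E n) by exact: bigcup_measurable.
have intfE n : mu.-integrable (E n) (EFin \o f).
  by apply: (@integrableS _ _ _ mu _ _ _ mU (mE n) _ intf); exact: bigcup_sup.
have mf : measurable_fun (\bigcup_n E n) (EFin \o f) by exact: measurable_int intf.
apply: fine_cvg; rewrite fineK; last exact: integrable_fin_num.
pose g n := (EFin \o f) \_ (E n).
have [] := @dominated_convergence _ _ _ mu _ mU g (EFin \o f)
  (fun x => `|(f x)%:E|%E).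
- move=> n; apply: measurable_funTS.
  apply/(measurable_restrictT _ (mE n : measurable (E n : set (measurableTypeR R)))).
  exact: measurable_int (intfE n).
- exact: mf.
- apply: aeW => x [n _ Enx].
  apply: cvg_near_cst; exists n => // m /= nm.
  rewrite /g patchE mem_set//.
  by have := ndE _ _ nm; rewrite subsetEset; apply.
- exact: integrable_abse.
- apply: aeW => x n _; rewrite /g patchE; case: ifPn => // _.
  by rewrite -[point]/(0%E) abse0 abse_ge0.
move=> _ _; rewrite (_ : [sequence _]_n =
    fun n => (\int[mu]_(x in E n) (f x)%:E)%E)//.
apply/funext => n /=; rewrite /g -integral_mkcondr.
congr (integral _ _ _); apply/setIidPr; exact: bigcup_sup.
Qed.

(** Monotone convergence: the integrals over [E n] increase to the integral over the union, which
    [C] therefore bounds. *)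
Lemma integrable_exhaustion (E : (set R)^nat) f C :
  nondecreasing_seq E -> (forall n, measurable (E n)) ->
  measurable_fun (\bigcup_n E n) f -> (forall n x, E n x -> 0 <= f x) ->
  (forall n, mu.-integrable (E n) (EFin \o f)) ->
  (forall n, \int[mu]_(x in E n) f x <= C) ->
  mu.-integrable (\bigcup_n E n) (EFin \o f).
Proof.
move=> ndE mE mf f0 intf leC.
have mfE n : measurable_fun (E n : set (measurableTypeR R)) (EFin \o f) by exact: measurable_int (intf n).
apply/integrableP; split; first exact/measurable_EFinP.
under eq_integral => x /[!inE] -[n _ /f0 fx0] do rewrite /= ger0_norm//.
have cv := @ge0_nondecreasing_set_cvg_integral _ (measurableTypeR R) _ E (EFin \o f) mu ndE mE mfE
  (fun n x Ex => f0 n x Ex).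
apply: (@le_lt_trans _ _ C%:E); last by rewrite ltry.
rewrite -(cvg_lim _ cv)//; apply: lime_le; first by apply/cvg_ex; eexists; exact: cv.
apply: nearW => n /=.
rewrite -[leLHS]fineK; last by apply: (@integrable_fin_num _ _ _ mu _ (mE n)); exact: intf.
by rewrite lee_fin; exact: leC.
Qed.

Lemma continuous_itv_integrable (a b : R) f :
  {in `[a, b], forall x : R, {for x, continuous f}} ->
  mu.-integrable `[a, b] (EFin \o f).
Proof.
move=> cf; apply: continuous_compact_integrable; first exact: segment_compact.
by apply: continuous_in_subspaceT => x /[!inE] xab; exact: cf.
Qed.

Lemma Rintegral_FTC2 (a b : R) f F : a < b ->
  {in `[a, b], forall x : R, {for x, continuous f}} ->
  {in `[a, b], forall x : R, has_derive F x (f x)} ->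
  \int[mu]_(x in `[a, b]) f x = F b - F a.
Proof.
move=> ab cf dF; rewrite /Rintegral (@continuous_FTC2 _ _ F)//.
- by apply: continuous_in_subspaceT => x /[!inE] xab; exact: cf.
- have cF x : x \in `[a, b] -> {for x, continuous F}.
    move=> xab; apply: differentiable_continuous; apply/derivable1_diffP.
    by have [] := dF _ xab.
  split.
  + by move=> x xab; have [] := dF _ (subset_itv_oo_cc xab).
  + by apply: cvg_at_right_filter; apply: cF; rewrite in_itv/= lexx ltW.
  + by apply: cvg_at_left_filter; apply: cF; rewrite in_itv/= lexx ltW.
- move=> x xab; rewrite derive1E.
  by have /@derive_val := dF _ (subset_itv_oo_cc xab).
Qed.

(** Compact exhaustion of the open half-line. Starting at [n.+2] makes the first interval
    nondegenerate too, as the fundamental theorem of calculus asks for. *)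
Let pitv n : set R := `[n.+2%:R^-1, n.+2%:R].

Let pitv_lt n : n.+2%:R^-1 < n.+2%:R :> R.
Proof. by rewrite (@lt_trans _ _ 1)// ?invf_lt1 ?ltr1n ?ltr0n. Qed.

Let pitv_gt0 n x : x \in `[n.+2%:R^-1, n.+2%:R] -> 0 < x :> R.
Proof. by rewrite in_itv/= => /andP[+ _]; apply: lt_le_trans; rewrite invr_gt0. Qed.

Let pitv_nd : nondecreasing_seq pitv.
Proof.
move=> m n mn; rewrite subsetEset /pitv; apply: subset_itvScc; rewrite bnd_simp.
  by rewrite lef_pV2 ?posrE// ler_nat.
by rewrite ler_nat.
Qed.

Let pitvE : \bigcup_n pitv n = `]0, +oo[%classic.
Proof.
apply/seteqP; split=> [x [n _]|x] /=; first by move/pitv_gt0; rewrite in_itv/= andbT.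
rewrite in_itv/= andbT => x0; exists (Num.bound (x + x^-1)) => //=.
have xi0 : 0 < x^-1 by rewrite invr_gt0.
have : x + x^-1 < (Num.bound (x + x^-1)).+2%:R.
  rewrite (lt_trans (archi_boundP _))// ?ltr_nat// ?ltnW//.
  by rewrite addr_ge0// ltW.
set N := _.+2%:R => xN; rewrite /pitv/=; have N0 : 0 < N by rewrite ltr0n.
rewrite in_itv/=; apply/andP; split; last lra.
rewrite -/N -(invrK x) lef_pV2 ?posrE//; lra.
Qed.

(** The fundamental theorem on each [pitv n], followed by the limit in [n] on both sides. *)
Lemma Rintegral_pos_FTC f F (l0 l : R) :
  (forall x : R, 0 < x -> {for x, continuous f}) ->
  (forall x : R, 0 < x -> has_derive F x (f x)) ->
  mu.-integrable `]0, +oo[ (EFin \o f) ->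
  F x @[x --> 0^'+] --> l0 -> F x @[x --> +oo] --> l ->
  \int[mu]_(x in `]0, +oo[) f x = l - l0.
Proof.
move=> cf dF intf F0 Foo.
have nz n : (n.+2%:R^-1 : R) > 0 by rewrite invr_gt0.
have lim0 : F (n.+2%:R^-1) @[n --> \oo] --> l0.
  move/cvg_at_rightP : F0; apply; split=> //.
  exact: (cvg_comp (addn 1) _ (cvg_addnl 1) cvg_harmonic).
have limoo : F (n.+2%:R) @[n --> \oo] --> l.
  move/cvg_pinftyP : Foo; apply.
  exact: (cvg_comp (addn 2) _ (cvg_addnl 2) (@cvgr_idn R)).
rewrite -pitvE in intf *.
have lhs := cvg_Rintegral_exhaustion pitv_nd (fun n => measurable_itv _) intf.
apply: (cvg_unique _ lhs) => //.
rewrite /= (_ : (fun n => _) = fun n => F n.+2%:R - F n.+2%:R^-1); first exact: cvgB.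
by apply/funext => n; apply: Rintegral_FTC2 => // x /pitv_gt0; [exact: cf|exact: dF].
Qed.

Lemma open_continuous_in (D : set R) f : open D ->
  (forall x : R, D x -> {for x, continuous f}) -> measurable_fun D f.
Proof.
by move=> oD cf; apply: open_continuous_measurable_fun => // x /[!inE]; exact: cf.
Qed.

(** The integral over [pitv n] is a difference of two values of [F], hence at most [C + C];
    integrability is thus read off from an explicit primitive. *)
Lemma integrable_pos_primitive f F C :
  (forall x : R, 0 < x -> {for x, continuous f}) -> (forall x : R, 0 < x -> 0 <= f x) ->
  (forall x : R, 0 < x -> has_derive F x (f x)) ->
  (forall x : R, 0 < x -> `|F x| <= C) ->
  mu.-integrable `]0, +oo[ (EFin \o f).
Proof.
move=> cf f0 dF FC; rewrite -pitvE.
apply: (@integrable_exhaustion _ _ (C + C)) => //.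
- by move=> n; exact: measurable_itv.
- rewrite pitvE; apply: open_continuous_in; first exact: interval_open.
  by move=> x /=; rewrite in_itv/= andbT; exact: cf.
- by move=> n x /pitv_gt0; exact: f0.
- by move=> n; apply: continuous_itv_integrable => x /pitv_gt0; exact: cf.
move=> n; rewrite (@Rintegral_FTC2 _ _ _ F)//.
- have /FC : 0 < n.+2%:R^-1 :> R by rewrite invr_gt0.
  have /FC : 0 < n.+2%:R :> R by [].
  by rewrite !ler_norml; lra.
- by move=> x /pitv_gt0; exact: cf.
- by move=> x /pitv_gt0; exact: dF.
Qed.

(** The counterpart of [pitv] for a closed left half-line. *)
Let nitv (x : R) n : set R := `[x - n.+1%:R, x].

Let nitv_nd x : nondecreasing_seq (nitv x).
Proof.
move=> m n mn; rewrite subsetEset /nitv; apply: subset_itvScc; rewrite bnd_simp//.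
by rewrite lerB// ler_nat.
Qed.

Let nitvE x : \bigcup_n nitv x n = `]-oo, x]%classic.
Proof.
apply/seteqP; split=> [y [n _]|y] /=; first by rewrite /nitv/= !in_itv/= => /andP[].
rewrite in_itv/= => yx; exists (Num.bound (x - y)) => //=.
have : x - y < (Num.bound (x - y)).+1%:R.
  by rewrite (lt_trans (archi_boundP _))// ?ltr_nat// subr_ge0.
by rewrite /nitv/= in_itv/= yx andbT => h; rewrite lerBlDr -lerBlDl ltW.
Qed.

Let nitv_lt (x : R) n : x - n.+1%:R < x.
Proof. by rewrite ltrBlDr ltrDl. Qed.

Lemma integrable_Ny_primitive f F (x C : R) :
  (forall y : R, y <= x -> {for y, continuous f}) -> (forall y : R, y <= x -> 0 <= f y) ->
  (forall y : R, y <= x -> has_derive F y (f y)) ->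
  (forall y : R, y <= x -> `|F y| <= C) ->
  mu.-integrable `]-oo, x] (EFin \o f).
Proof.
move=> cf f0 dF FC; rewrite -nitvE.
have le_x y n : nitv x n y -> y <= x by rewrite /nitv/= in_itv/= => /andP[].
have int_n n : mu.-integrable (nitv x n) (EFin \o f).
  by apply: continuous_itv_integrable => y /le_x; exact: cf.
apply: (@integrable_exhaustion _ _ (C + C)) => //.
- by move=> n; exact: measurable_itv.
- rewrite nitvE; apply: subspace_continuous_measurable_fun.
    exact: measurable_itv.
  apply: continuous_in_subspaceT => y /[!inE]/=; rewrite in_itv/=; exact: cf.
- by move=> n y /le_x; exact: f0.
move=> n; rewrite (@Rintegral_FTC2 _ _ _ F)//.
- have := FC _ (lexx x).
  have /FC : x - n.+1%:R <= x by exact/ltW.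
  by rewrite !ler_norml; lra.
- by move=> y /le_x; exact: cf.
- by move=> y /le_x; exact: dF.
Qed.

Lemma Rintegral_Ny_FTC f F (x l : R) :
  (forall y : R, y <= x -> {for y, continuous f}) ->
  (forall y : R, y <= x -> has_derive F y (f y)) ->
  mu.-integrable `]-oo, x] (EFin \o f) -> F y @[y --> -oo] --> l ->
  \int[mu]_(y in `]-oo, x]) f y = F x - l.
Proof.
move=> cf dF intf Foo.
have le_x y n : y \in `[x - n.+1%:R, x] -> y <= x by rewrite in_itv/= => /andP[].
have limoo : F (x - n.+1%:R) @[n --> \oo] --> l.
  move/cvg_ninftyP : Foo; apply.
  apply/cvgrNyPle => M; near=> n; rewrite lerBlDr -lerBlDl.
  near: n; exists (Num.bound `|x - M|) => // n /= le_n.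
  rewrite (le_trans (ler_norm _))// ltW// (lt_le_trans (archi_boundP _))//.
  rewrite ler_nat; apply: leq_trans (leqnSn _).
  exact: le_n.
rewrite -nitvE in intf *.
have lhs := cvg_Rintegral_exhaustion (@nitv_nd x) (fun n => measurable_itv _) intf.
apply: (cvg_unique _ lhs) => //.
rewrite /= (_ : (fun n => _) = fun n => F x - F (x - n.+1%:R)).
  by apply: cvgB => //; exact: cvg_cst.
by apply/funext => n; apply: Rintegral_FTC2 => // y /le_x; [exact: cf|exact: dF].
Unshelve. all: by end_near. Qed.

(** Lebesgue measure is its own image under negation, so this is the change of variables for a
    pushforward. *)
Lemma Rintegral_reflect f : measurable_fun setT f ->
  mu.-integrable `]0, +oo[ (EFin \o (f \o -%R)) ->
  mu.-integrable `]-oo, 0[ (EFin \o f) /\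
  \int[mu]_(x in `]-oo, 0[) f x = \int[mu]_(x in `]0, +oo[) f (- x).
Proof.
move=> mf intf.
pose phi : measurableTypeR R -> measurableTypeR R := -%R.
have mphi : measurable_fun [set: measurableTypeR R] phi by exact: oppr_measurable.
have phiE : phi @^-1` `]-oo, 0[ = `]0, +oo[%classic.
  by apply/seteqP; split=> y /=; rewrite !in_itv/= /phi oppr_lt0// andbT.
have mfE : measurable_fun [set: measurableTypeR R] (EFin \o f) by exact/measurable_EFinP.
have mI : measurable (`]-oo, 0[%classic : set (measurableTypeR R)) by exact: measurable_itv.
have intf' : mu.-integrable (phi @^-1` `]-oo, 0[) ((EFin \o f) \o phi) by rewrite phiE.
have := integrable_pushforward mphi mfE intf' mI.
have := integral_pushforward mphi mfE intf' mI.
have eqm (g : R -> \bar R) : (\int[pushforward mu phi]_(y in `]-oo, 0%R[) g y =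
    \int[mu]_(y in `]-oo, 0%R[) g y)%E.
  by apply: eq_measure_integral => A mA _; exact: lebesgue_measureN.
rewrite eqm.
rewrite phiE => e /integrableP[mf' foo]; split; last by rewrite /Rintegral e.
apply/integrableP; split => //.
by move: foo; rewrite eqm.
Qed.

(** On each [pitv n] this is the substitution rule for compact intervals. The limits of [F] at both
    ends make the images [E n] exhaust the half-line again. *)
Lemma Rintegral_pos_subst f F F' :
  (forall x y : R, 0 < x -> x < y -> F x < F y) -> (forall x : R, 0 < x -> 0 < F x) ->
  (forall x : R, 0 < x -> has_derive F x (F' x)) ->
  (forall x : R, 0 < x -> {for x, continuous F'}) ->
  F x @[x --> 0^'+] --> 0 -> F x @[x --> +oo] --> +oo ->
  (forall x : R, 0 < x -> {for x, continuous f}) ->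
  mu.-integrable `]0, +oo[ (EFin \o f) ->
  mu.-integrable `]0, +oo[ (EFin \o (fun x => f (F x) * F' x)) ->
  \int[mu]_(x in `]0, +oo[) f x = \int[mu]_(x in `]0, +oo[) (f (F x) * F' x).
Proof.
move=> F_lt F_gt0 dF cF' F0 Foo cf intf intfF.
pose E n : set R := `[F n.+2%:R^-1, F n.+2%:R]%classic.
have n_gt0 n : 0 < n.+2%:R^-1 :> R by rewrite invr_gt0.
have F_le (x y : R) : 0 < x -> x <= y -> F x <= F y.
  by move=> x0; rewrite le_eqVlt => /predU1P[->//|xy]; exact/ltW/F_lt.
have E_nd : nondecreasing_seq E.
  move=> m n mn; rewrite subsetEset /E; apply: subset_itvScc; rewrite bnd_simp.
    by rewrite F_le// lef_pV2 ?posrE// ler_nat.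
  by rewrite F_le// ler_nat.
have EE : \bigcup_n E n = `]0, +oo[%classic.
  apply/seteqP; split=> [x [n _]|x] /=; rewrite /E/= !in_itv/=.
    by move=> /andP[+ _]; rewrite andbT; apply: lt_le_trans; exact: F_gt0.
  rewrite andbT => x0.
  have cv0 : F n.+2%:R^-1 @[n --> \oo] --> 0.
    move/cvg_at_rightP : F0; apply; split=> //.
    exact: (cvg_comp (addn 1) _ (cvg_addnl 1) cvg_harmonic).
  have cvoo : F n.+2%:R @[n --> \oo] --> +oo.
    apply: cvg_comp Foo; exact: (cvg_comp (addn 2) _ (cvg_addnl 2) (@cvgr_idn R)).
  near \oo => n; exists n => //=; rewrite in_itv/=; apply/andP; split.
    by near: n; apply: cvgr_le cv0 _ x0.
  by near: n; move/cvgryPge : cvoo; exact.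
have Rint n : \int[mu]_(x in E n) f x =
    \int[mu]_(x in pitv n) (f (F x) * F' x).
  have dFE x : x \in `[n.+2%:R^-1, n.+2%:R] -> derive1 F x = F' x.
    by move/pitv_gt0/dF => d; rewrite derive1E; exact: derive_val.
  have cFx (x : R) : 0 < x -> {for x, continuous F}.
    move=> x0; apply: differentiable_continuous; apply/derivable1_diffP.
    by have [] := dF _ x0.
  have cF1 (x : R) : 0 < x -> derive1 F y @[y --> x] --> F' x.
    move=> x0; have := cF' _ x0; apply: cvg_trans; apply: near_eq_cvg.
    near=> y; rewrite derive1E.
    have y0 : 0 < y by near: y; exact: lt_nbhsr.
    by apply/esym; have := dF _ y0 => d; exact: derive_val.
  rewrite /Rintegral /E integration_by_substitution_increasing.
  - congr fine; apply: eq_integral => x /[!inE] xn.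
    by rewrite fctE/= dFE.
  - exact: ltW.
  - by move=> x y /pitv_gt0 x0 /pitv_gt0 y0; exact: F_lt.
  - move=> x xn; have x0 := pitv_gt0 (subset_itv_oo_cc xn).
    by rewrite /continuous_at (dFE _ (subset_itv_oo_cc xn)); exact: cF1.
  - by apply/cvg_ex; exists (F' n.+2%:R^-1); apply: cvg_at_right_filter; exact: cF1.
  - by apply/cvg_ex; exists (F' n.+2%:R); apply: cvg_at_left_filter; exact: cF1.
  - split.
    + by move=> x /subset_itv_oo_cc/pitv_gt0/dF[].
    + by apply: cvg_at_right_filter; exact: cFx.
    + by apply: cvg_at_left_filter; exact: cFx.
  - apply: continuous_in_subspaceT => x /[!inE]/=; rewrite in_itv/= => /andP[+ _].
    by move=> h; apply: cf; apply: lt_le_trans h; exact: F_gt0.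
have intE : mu.-integrable (\bigcup_n E n) (EFin \o f) by rewrite EE.
have lhs := cvg_Rintegral_exhaustion E_nd (fun n => measurable_itv _) intE.
rewrite -pitvE in intfF *.
have rhs := cvg_Rintegral_exhaustion pitv_nd (fun n => measurable_itv _) intfF.
rewrite pitvE -EE; apply: (cvg_unique _ lhs) => //.
by rewrite /= (funext Rint) EE -pitvE.
Unshelve. all: by end_near. Qed.

End integration.

(** * Powers against stretched exponentials *)

Section powR_expR.
Context {R : realType}.
Local Notation mu := (@lebesgue_measure R).
Implicit Types (q r a lam t : R).

(** For [k = r / a] and [u = lam * t ^ a], raising [u / k <= exp (u / k)] to the power [k] gives
    [(u / k) ^ k <= exp u]. *)
Lemma powR_expR_le r a lam t : 0 < r -> 0 < a -> 0 < lam -> 0 < t ->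
  t `^ r * expR (- (lam * t `^ a)) <= (r / (a * lam)) `^ (r / a).
Proof.
move=> r0 a0 l0 t0; set k := r / a; set u := lam * t `^ a.
have k0 : 0 < k by rewrite divr_gt0.
have u0 : 0 < u by rewrite mulr_gt0// powR_gt0.
have : (u / k) `^ k <= expR u.
  rewrite -[in leRHS](divfK (lt0r_neq0 k0) u) expRM ge0_ler_powR ?nnegrE ?expR_ge0//.
  - exact: ltW.
  - by rewrite ltW// divr_gt0.
  by rewrite (le_trans _ (expR_ge1Dx _))// ler_wpDl.
have -> : (u / k) `^ k = t `^ r / (r / (a * lam)) `^ k.
  rewrite (_ : u / k = (t `^ a) * (r / (a * lam))^-1); last first.
    by rewrite /u /k; field; rewrite !gt_eqF.
  rewrite powRM ?powR_ge0 ?invr_ge0 ?divr_ge0 ?mulr_ge0 ?ltW// -powRrM.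
  rewrite (_ : a * k = r); last by rewrite /k; field; rewrite gt_eqF.
  rewrite -powR_inv1 ?divr_ge0 ?mulr_ge0 ?ltW//.
  by rewrite powRAC powR_inv1// powR_ge0.
rewrite ler_pdivrMr ?powR_gt0 ?divr_gt0 ?mulr_gt0// => h.
by rewrite expRN ler_pdivrMr ?expR_gt0// mulrC.
Qed.

(** One majorant serves at both ends: [t ^ (q - 1) / (1 + t ^ q) ^ 2] has the bounded primitive
    [- 1 / (q * (1 + t ^ q))]. *)
Lemma integrable_powR_expR q a lam : 0 < q -> 0 < a -> 0 < lam ->
  mu.-integrable `]0, +oo[ (EFin \o (fun t => t `^ (q - 1) * expR (- (lam * t `^ a)))).
Proof.
move=> q0 a0 l0.
(* The three terms of [K] bound the exponential times the three terms of [(1 + t ^ q) ^ 2]. *)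
pose K := 1 + 2 * (q / (a * lam)) `^ (q / a) + ((q + q) / (a * lam)) `^ ((q + q) / a).
pose g t := K * (t `^ (q - 1) * (1 + t `^ q) ^- 2).
have pos t : `]0%R, +oo[%classic t -> 0 < t by rewrite /= in_itv/= andbT.
have den t : 1 + t `^ q != 0 by rewrite gt_eqF// ltr_wpDr// powR_ge0.
have K0 : 0 <= K by rewrite /K !addr_ge0 ?mulr_ge0 ?powR_ge0.
apply: (@integrable_dominated _ _ _ g) => //.
- apply: open_continuous_in; first exact: interval_open.
  by move=> t /pos t0; apply: has_derive_continuous; der.
- move=> t /pos t0; rewrite ger0_norm ?mulr_ge0 ?powR_ge0 ?expR_ge0//.
  rewrite /g mulrCA ler_wpM2l ?powR_ge0//.
  rewrite ler_pdivlMr ?exprn_gt0 ?ltr_wpDr ?powR_ge0//.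
  have := powR_expR_le q0 a0 l0 t0.
  have := powR_expR_le (addr_gt0 q0 q0) a0 l0 t0.
  rewrite powRD ?(gt_eqF t0) ?implybT//.
  have : expR (- (lam * t `^ a)) <= 1.
    by rewrite -expR0 ler_expR oppr_le0 mulr_ge0 ?powR_ge0 ?ltW.
  rewrite /K; set x := t `^ q; set e := expR _ => e1 h2 h1.
  by rewrite (_ : e * _ = e + 2 * (x * e) + x * x * e); [lra|ring].
- apply: (@integrable_pos_primitive R g (fun t => - (K / q) * (1 + t `^ q)^-1) (K / q)).
  + move=> t t0; apply: has_derive_continuous; rewrite /g; der => //.
    by rewrite expf_neq0.
  + move=> t t0; rewrite /g mulr_ge0// mulr_ge0 ?powR_ge0// invr_ge0 exprn_ge0//.
    by rewrite addr_ge0 ?powR_ge0.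
  + move=> t t0; apply: has_derive_eq.
      by der.
    by rewrite /g; field; rewrite den gt_eqF.
  + move=> t t0; rewrite mulNr normrN ger0_norm; last first.
      apply: divr_ge0; last by rewrite addr_ge0 ?powR_ge0.
      by apply: divr_ge0 => //; exact: ltW.
    apply: ler_piMr; first by apply: divr_ge0 => //; exact: ltW.
    rewrite invf_le1 ?lerDl ?powR_ge0//.
    by rewrite ltr_wpDr// powR_ge0.
Qed.

(** The substitution [s = lam * t ^ a] in the Gamma integral. *)
Lemma Gamma_powR_expR p a lam : 0 < p -> 0 < a -> 0 < lam ->
  Gamma (p / a) = a * lam `^ (p / a) *
    \int[mu]_(t in `]0, +oo[) (t `^ (p - 1) * expR (- (lam * t `^ a))).
Proof.
move=> p0 a0 l0; have pa0 : 0 < p / a by rewrite divr_gt0.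
have pos t : `]0%R, +oo[%classic t -> 0 < t by rewrite /= in_itv/= andbT.
pose f t := t `^ (p / a - 1) * expR (- t).
pose F t := lam * t `^ a; pose F' t := lam * (a * t `^ (a - 1)).
have fE : {in `]0, +oo[%classic, (fun t => f (F t) * F' t) =1
    (fun t => a * lam `^ (p / a) * (t `^ (p - 1) * expR (- (lam * t `^ a))))}.
  move=> t /[!inE] /pos t0; rewrite /f /F /F'.
  rewrite powRM ?powR_ge0// ?ltW// -powRrM.
  have -> : lam `^ (p / a - 1) = lam `^ (p / a) * lam^-1.
    by rewrite powRD ?(gt_eqF l0) ?implybT// powR_inv1 ?ltW.
  have -> : t `^ (a * (p / a - 1)) = t `^ (p - 1) * (t `^ (a - 1))^-1.
    rewrite -powRN -powRD ?(gt_eqF t0) ?implybT//; congr powR.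
    by field; rewrite gt_eqF.
  by field; rewrite !gt_eqF// powR_gt0.
have intf : mu.-integrable `]0, +oo[ (EFin \o f).
  have := integrable_powR_expR pa0 ltr01 ltr01.
  apply: eq_integrable => // t /[!inE] /pos t0.
  by rewrite /f /= mul1r powRr1// ltW.
rewrite /Gamma (@Rintegral_pos_subst _ f F F').
- rewrite (@eq_Rintegral _ _ _ mu _ _ _ fE) RintegralZl//; exact: integrable_powR_expR.
- move=> x y x0 xy; rewrite /F ltr_pM2l// gt0_ltr_powR// ?nnegrE ltW//.
  exact: lt_trans xy.
- by move=> x x0; rewrite /F mulr_gt0// powR_gt0.
- move=> x x0; apply: has_derive_eq; first by rewrite /F; der.
  by rewrite /F'; ring.
- by move=> x x0; apply: has_derive_continuous; rewrite /F'; der.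
- rewrite -[X in _ --> X](mulr0 lam); apply: cvgM; first exact: cvg_cst.
  exact: powR_cvg0.
- apply/cvgryPge => M; near=> x.
  have x0 : 0 < x by near: x; exact: nbhs_pinfty_gt.
  rewrite /F -ler_pdivrMl//.
  have [M0|M0] := leP (lam^-1 * M) 0; first by rewrite (le_trans M0)// powR_ge0.
  rewrite -[leLHS]powRr1 ?ltW// -(mulVf (lt0r_neq0 a0)) powRrM.
  rewrite gt0_ltr_powR ?nnegrE ?powR_ge0 ?(ltW x0)//.
- by move=> x x0; apply: has_derive_continuous; rewrite /f; der.
- exact: intf.
- have : mu.-integrable `]0, +oo[ (EFin \o
      (fun t => a * lam `^ (p / a) * (t `^ (p - 1) * expR (- (lam * t `^ a))))).
    apply: integrable_scale => //.
    exact: integrable_powR_expR.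
  by apply: eq_integrable => // t tI /=; rewrite (fE t tI).
Unshelve. all: by end_near. Qed.

End powR_expR.

(** * Integrals depending on a parameter *)

Section under_integral.
Context {R : realType}.
Local Notation mu := (@lebesgue_measure R).
Variables (f df : R -> R -> R) (g : R -> R) (u v : R).
Hypothesis intf : {in `]u, v[, forall x : R, mu.-integrable `]0, +oo[ (EFin \o f x)}.
Hypothesis derf : {in `]u, v[, forall x t : R, 0 < t -> has_derive (f ^~ t) x (df x t)}.
Hypothesis g_ge0 : forall t, 0 <= g t.
Hypothesis intg : mu.-integrable `]0, +oo[ (EFin \o g).
Hypothesis df_le : {in `]u, v[, forall x t : R, 0 < t -> `|df x t| <= g t}.

Lemma has_derive_Rintegral x : x \in `]u, v[ ->
  has_derive (fun y => \int[mu]_(t in `]0, +oo[) f y t) x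
    (\int[mu]_(t in `]0, +oo[) df x t).
Proof.
move=> xuv.
have pos (t : R) : `]0%R, +oo[%classic t -> 0 < t by rewrite /= in_itv/= andbT.
have mI : measurable (`]0, +oo[%classic : set (measurableTypeR R)) by exact: measurable_itv.
have d1E y t : y \in `]u, v[ -> 0 < t -> partial1of2 f y t = df y t.
  by move=> yuv t0; rewrite /partial1of2; exact: has_derive1E (derf yuv t0).
have dd y t : `]u, v[%classic y -> `]0, +oo[%classic t -> derivable (f ^~ t) y 1.
  by move=> yuv /pos t0; have [] := derf yuv t0.
have bd y t : `]u, v[%classic y -> `]0, +oo[%classic t -> `|partial1of2 f y t| <= g t.
  by move=> yuv /pos t0; rewrite d1E//; exact: df_le.
have dI := derivable_under_integral mI xuv intf dd g_ge0 intg bd.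
have := differentiation_under_integral mI xuv intf dd g_ge0 intg bd.
rewrite derive1E => eI; apply: (@DeriveDef _ _ _ _ _ _ _ dI); rewrite eI.
by apply: eq_Rintegral => t /[!inE] /pos t0; rewrite d1E.
Qed.

End under_integral.

Section integral_increment.
Context {R : realType}.
Local Notation mu := (@lebesgue_measure R).

Lemma has_derive_lipschitz (f df : R -> R) (u v M x y : R) :
  {in `[u, v], forall z : R, has_derive f z (df z)} ->
  {in `[u, v], forall z : R, `|df z| <= M} ->
  x \in `[u, v] -> y \in `[u, v] -> `|f y - f x| <= M * `|y - x|.
Proof.
move=> fd fM; wlog xy : x y / x <= y.
  move=> wl xuv yuv; have [xy|/ltW yx] := leP x y; first exact: wl.
  by rewrite distrC [X in M * X]distrC wl.
move=> xuv yuv.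
have sub z : z \in `[x, y] -> z \in `[u, v].
  by move: xuv yuv; rewrite !in_itv/= => *; lra.
have dxy z : z \in `]x, y[ -> is_derive z 1 f (df z) by move=> /subset_itv_oo_cc/sub/fd.
have cxy : {within `[x, y], continuous f}.
  by apply: continuous_in_subspaceT => z /[!inE]/=/sub/fd; exact: has_derive_continuous.
have [z zxy ->] := MVT_segment xy dxy cxy.
by rewrite normrM ler_wpM2r// fM// sub.
Qed.

(** The derivative of the integral in the parameter is the constant [s], so the integral is affine.
    Differentiation under the integral covers the open interval; the Lipschitz bound [K_lip] gives
    the continuity at the end points that the mean value theorem asks for. *)
Lemma Rintegral_increment (f df : R -> R -> R) (g : R -> R) (u v s : R) : u <= v ->
  {in `[u, v], forall x : R, mu.-integrable `]0, +oo[ (EFin \o f x)} ->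
  {in `[u, v], forall x t : R, 0 < t -> has_derive (f ^~ t) x (df x t)} ->
  (forall t, 0 <= g t) -> mu.-integrable `]0, +oo[ (EFin \o g) ->
  {in `[u, v], forall x t : R, 0 < t -> `|df x t| <= g t} ->
  {in `[u, v], forall x : R, \int[mu]_(t in `]0, +oo[) df x t = s} ->
  \int[mu]_(t in `]0, +oo[) f v t - \int[mu]_(t in `]0, +oo[) f u t = s * (v - u).
Proof.
move=> uv intf derf g0 intg dfg ints.
have pos (t : R) : `]0%R, +oo[%classic t -> 0 < t by rewrite /= in_itv/= andbT.
have mI : measurable (`]0, +oo[%classic : set (measurableTypeR R)) by exact: measurable_itv.
pose K x := \int[mu]_(t in `]0, +oo[) f x t.
pose C := \int[mu]_(t in `]0, +oo[) g t.
have K_lip x y : x \in `[u, v] -> y \in `[u, v] -> `|K y - K x| <= C * `|y - x|.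
  move=> xuv yuv; rewrite /K -RintegralB//; [|exact: intf|exact: intf].
  have intB : mu.-integrable `]0, +oo[ (EFin \o (fun t => f y t - f x t)).
    by have := integrableB mI (intf _ yuv) (intf _ xuv); apply: eq_integrable.
  have intC : mu.-integrable `]0, +oo[ (EFin \o (fun t => g t * `|y - x|)).
    by have := integrableZr mI `|y - x| intg; apply: eq_integrable.
  rewrite (le_trans (le_normr_Rintegral mI intB))// /C -RintegralZr//.
  apply: le_Rintegral => //; first exact: integrable_norm.
  move=> t /pos t0; apply: (@has_derive_lipschitz (f ^~ t) (df ^~ t) u v) => //.
  - by move=> z zuv; exact: derf.
  - by move=> z zuv; exact: dfg.
have C0 : 0 <= C by apply: Rintegral_ge0 => t _.
have dK x : x \in `]u, v[ -> is_derive x 1 K s.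
  move=> xuv; rewrite -(ints x (subset_itv_oo_cc xuv)).
  apply: (@has_derive_Rintegral _ f df g u v) => //.
  - by move=> y /subset_itv_oo_cc; exact: intf.
  - by move=> y /subset_itv_oo_cc; exact: derf.
  - by move=> y /subset_itv_oo_cc; exact: dfg.
suff cK : {within `[u, v], continuous K}.
  by have [z zuv] := @MVT_segment _ K (fun=> s) _ _ uv dK cK.
apply/subspace_continuousP => x /= xuv; apply/cvgrPdist_le => /= e e0.
near=> y; rewrite (@le_trans _ _ (C * `|x - y|))//.
    by apply: K_lip => //; near: y; exact: withinT.
  (* [C] may be 0, so the radius is computed from [C + 1]. *)
  have C10 : 0 < C + 1 by rewrite ltr_wpDl.
  rewrite (@le_trans _ _ ((C + 1) * `|x - y|))// ?ler_wpM2r// ?lerDl//.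
  rewrite -ler_pdivlMl//; near: y; apply: cvg_within.
  apply/nbhs_ballP; exists ((C + 1)^-1 * e) => /=; first by rewrite mulr_gt0 ?invr_gt0 ?ltr_wpDl.
  by move=> z; exact: ltW.
Unshelve. all: by end_near. Qed.

End integral_increment.

(** * Rotation of the ray of integration *)

Section trigo_bounds.
Context {R : realType}.
Implicit Types x y u : R.

Lemma norm_mul_le x y : `|y| <= 1 -> `|x * y| <= `|x|.
Proof. by move=> y1; rewrite normrM ler_piMr. Qed.

Lemma sin_lipschitz x y : `|sin y - sin x| <= `|y - x|.
Proof.
have := @has_derive_lipschitz R sin cos (Num.min x y) (Num.max x y) 1 x y.
rewrite mul1r; apply.
- by move=> z _; exact: is_derive_sin.
- by move=> z _; exact: cos_max.
- by rewrite in_itv/= ge_min le_max lexx.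
- by rewrite in_itv/= ge_min le_max lexx !orbT.
Qed.

Lemma norm_sin_le x : `|sin x| <= `|x|.
Proof. by have := sin_lipschitz 0 x; rewrite sin0 !subr0. Qed.

Lemma cos_le_abs x y : `|x| <= `|y| -> `|y| <= pi -> cos y <= cos x.
Proof.
move=> xy ypi; rewrite -(cos_norm x) -(cos_norm y).
by rewrite leNgt ltr_cos ?in_itv/= ?normr_ge0/= -?leNgt// (le_trans xy).
Qed.

(** With [u = t ^ a] this is the cost of dropping the factor [exp (- exp (- i * psi) * z ^ a)] on a
    ray: the damping and the phase shift contribute at most [u] each. *)
Lemma damped_sin u C S x : 0 <= u -> 0 <= C <= 1 -> `|S| <= 1 ->
  `|expR (- (u * C)) * sin (x - u * S) - sin x| <= 2 * u.
Proof.
move=> u0 /andP[C0 C1] S1; set e := expR _; set y := sin (x - _).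
have e1 : e <= 1 by rewrite /e -expR0 ler_expR oppr_le0 mulr_ge0.
have e0 : 1 - u <= e.
  by rewrite (le_trans _ (expR_ge1Dx _))// lerB// ler_piMr.
have -> : e * y - sin x = (e - 1) * y + (y - sin x) by ring.
rewrite (le_trans (ler_normD _ _))// (_ : 2 * u = u + u); last ring.
rewrite lerD//.
  rewrite normrM (le_trans (ler_piMr _ (sin_max _)))//.
  by rewrite distrC ger0_norm ?subr_ge0//; lra.
rewrite (le_trans (sin_lipschitz _ _))// (_ : x - u * S - x = - (u * S)); last ring.
rewrite normrN.
by rewrite normrM (ger0_norm u0) ler_piMr.
Qed.

Lemma damped_cos u C S x : 0 <= u -> 0 <= C <= 1 -> `|S| <= 1 ->
  `|expR (- (u * C)) * cos (x - u * S) - cos x| <= 2 * u.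
Proof.
move=> u0 C1 S1; have := @damped_sin u C S (x + pi / 2) u0 C1 S1.
by rewrite addrAC !sinDpihalf.
Qed.

End trigo_bounds.

(** * Dependence of the integral on the direction of the ray *)

Section rotation.
Context {R : realType}.
Local Notation mu := (@lebesgue_measure R).
Variables lam X a p psi kap : R.
Hypotheses (lam0 : 0 < lam) (X0 : 0 <= X) (a0 : 0 < a) (p0 : 0 <= p).

(** On the ray [z = t * exp (i * eta)], [A] is the real part of [i * X * z - lam * exp (- i * psi) *
    z ^ a]; [B] is its imaginary part plus the phase [p * eta] of [z ^ (p - 1) dz] and a constant
    phase [kap], which for [kap = - pi / 2] turns real parts into imaginary parts. [dA] and [dB] are
    the derivatives in [eta]. *)
Let A eta t := - (X * t * sin eta) - lam * t `^ a * cos (a * eta - psi).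
Let B eta t := p * eta + kap + X * t * cos eta - lam * t `^ a * sin (a * eta - psi).
Let dA eta t := - (X * t * cos eta) + lam * a * t `^ a * sin (a * eta - psi).
Let dB eta t := p - X * t * sin eta - lam * a * t `^ a * cos (a * eta - psi).

Definition ray_integrand eta t := t `^ (p - 1) * (expR (A eta t) * cos (B eta t)).

Let df eta t := t `^ (p - 1) *
  (expR (A eta t) * (dA eta t * cos (B eta t) - dB eta t * sin (B eta t))).

Let der_eta eta t : has_derive (ray_integrand ^~ t) eta (df eta t).
Proof.
apply: has_derive_eq; first by rewrite /ray_integrand /A /B; der.
by rewrite /df /dA /dB -/(A eta t) -/(B eta t); ring.
Qed.

Let powR_pred (t : R) r : 0 < t -> t `^ r = t `^ (r - 1) * t.
Proof. by move=> t0; rewrite mulrC -{2}(powRr1 (ltW t0)) -powRD ?(gt_eqF t0) ?implybT// addrC subrK. Qed.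

(** The Cauchy-Riemann equations in polar form: [t] times the [t]-derivatives of [A] and [B] are
    [dB - p] and [- dA]. Hence the derivative in the angle is exact along the ray. *)
Let der_t (eta t : R) : 0 < t ->
  has_derive (fun t => t `^ p * (expR (A eta t) * sin (B eta t))) t (- df eta t).
Proof.
move=> t0; apply: has_derive_eq; first by rewrite /A /B; der.
rewrite /df /dA /dB /A /B; set E := expR _.
set S := sin (p * eta + kap + _ - _); set C := cos (p * eta + kap + _ - _).
rewrite (powR_pred p t0) (powR_pred a t0); ring.
Qed.

Variables (u v c : R).
Hypotheses (uv : u <= v) (c0 : 0 < c).
(** [cosc] and [Xsin] keep the rays where the power term decays at a uniform rate and
    [exp (i * X * z)] stays bounded. For [p = 0], [pkap] makes the cosine vanish at the origin,
    against the factor [t ^ (- 1)]. *)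
Hypothesis cosc : {in `[u, v], forall eta, c <= cos (a * eta - psi)}.
Hypothesis Xsin : {in `[u, v], forall eta, 0 <= X * sin eta}.
Hypothesis pkap : 0 < p \/ p = 0 /\ cos kap = 0.

Let e t := expR (- (lam * c * t `^ a)).

Let expA_le eta t : eta \in `[u, v] -> 0 <= t -> expR (A eta t) <= e t.
Proof.
move=> euv t0; rewrite ler_expR /A.
have := Xsin euv; have := cosc euv.
have h : 0 <= lam * t `^ a by rewrite mulr_ge0 ?powR_ge0// ltW.
move=> /(ler_wpM2l h) h1 /(mulr_ge0 t0) h2.
rewrite (_ : X * t * sin eta = t * (X * sin eta)); last ring.
rewrite (_ : lam * c * t `^ a = lam * t `^ a * c); last ring.
lra.
Qed.

(** Majorant of the derivative in [eta], as a sum of terms within the reach of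
    [integrable_powR_expR]; for [p = 0] the first power is not integrable but has coefficient 0. *)
Let g t := p * (t `^ (p - 1) * e t) +
  (2 * X * (t `^ (p + 1 - 1) * e t) + 2 * lam * a * (t `^ (p + a - 1) * e t)).

Let mI : measurable (`]0, +oo[%classic : set (measurableTypeR R)).
Proof. exact: measurable_itv. Qed.

Let lc0 : 0 < lam * c. Proof. exact: mulr_gt0. Qed.

Let g_ge0 t : 0 <= g t.
Proof. by rewrite /g !addr_ge0// !mulr_ge0// ?powR_ge0 ?expR_ge0// ltW. Qed.

Let g_int : mu.-integrable `]0, +oo[ (EFin \o g).
Proof.
apply: integrable_add => //; last first.
  apply: integrable_add => //; apply: integrable_scale => //.
    by apply: integrable_powR_expR => //; rewrite ltr_wpDl.
  by apply: integrable_powR_expR => //; rewrite ltr_wpDl.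
case: pkap => [p0'|[-> _]].
  by apply: integrable_scale => //; exact: integrable_powR_expR.
apply: (@integrable_eq_pos _ (fun=> 0)) => [t _|]; first by rewrite mul0r.
exact: integrable0.
Qed.

Let powR_shift (t : R) r : 0 < t -> t `^ (p + r - 1) = t `^ (p - 1) * t `^ r.
Proof.
by move=> t0; rewrite -powRD ?(gt_eqF t0) ?implybT//; congr powR; ring.
Qed.

Let df_le : {in `[u, v], forall eta t : R, 0 < t -> `|df eta t| <= g t}.
Proof.
move=> eta euv t t0.
have -> : g t = t `^ (p - 1) * (e t * (p + 2 * (X * t) + 2 * (lam * a * t `^ a))).
  by rewrite /g !powR_shift// powRr1 ?(ltW t0)//; ring.
rewrite /df normrM (ger0_norm (powR_ge0 _ _)) ler_wpM2l ?powR_ge0//.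
rewrite normrM (ger0_norm (expR_ge0 _)) ler_pM ?expR_ge0// ?expA_le// ?(ltW t0)//.
have cB : `|dA eta t * cos (B eta t)| <= X * t + lam * a * t `^ a.
  rewrite (le_trans (norm_mul_le _ (cos_max _)))// /dA.
  rewrite (le_trans (ler_normD _ _))// normrN lerD//.
    rewrite (le_trans (norm_mul_le _ (cos_max _)))// ger0_norm// mulr_ge0//.
    exact: ltW.
  rewrite (le_trans (norm_mul_le _ (sin_max _)))// ger0_norm//.
  by rewrite !mulr_ge0 ?powR_ge0// ltW.
have sB : `|dB eta t * sin (B eta t)| <= p + X * t + lam * a * t `^ a.
  rewrite (le_trans (norm_mul_le _ (sin_max _)))// /dB.
  rewrite (le_trans (ler_normB _ _))// lerD//.
    rewrite (le_trans (ler_normB _ _))// lerD//; first by rewrite ger0_norm.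
    rewrite (le_trans (norm_mul_le _ (sin_max _)))// ger0_norm// mulr_ge0//.
    exact: ltW.
  rewrite (le_trans (norm_mul_le _ (cos_max _)))// ger0_norm//.
  by rewrite !mulr_ge0 ?powR_ge0// ltW.
rewrite (le_trans (ler_normB _ _))//; lra.
Qed.

Lemma integrable_ray_integrand :
  {in `[u, v], forall eta : R, mu.-integrable `]0, +oo[ (EFin \o ray_integrand eta)}.
Proof.
move=> eta euv.
have cont (t : R) : 0 < t -> {for t, continuous (ray_integrand eta)}.
  by move=> t0; apply: has_derive_continuous; rewrite /ray_integrand /A /B; der.
case: pkap => [p0'|[pE ckap]].
  apply: (@integrable_pos_dominated _ _ (fun t => t `^ (p - 1) * e t)) => //.
    move=> t t0; rewrite /ray_integrand normrM (ger0_norm (powR_ge0 _ _)) ler_wpM2l ?powR_ge0//.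
    rewrite (le_trans (norm_mul_le _ (cos_max _)))// ger0_norm ?expR_ge0//.
    by rewrite expA_le// ltW.
  exact: integrable_powR_expR.
apply: (@integrable_pos_dominated _ _ (fun t =>
  X * (t `^ (p + 1 - 1) * e t) + lam * (t `^ (p + a - 1) * e t))) => //; last first.
  apply: integrable_add => //; apply: integrable_scale => //.
    by apply: integrable_powR_expR => //; rewrite ltr_wpDl.
  by apply: integrable_powR_expR => //; rewrite ltr_wpDl.
move=> t t0; rewrite !powR_shift// powRr1 ?(ltW t0)//.
rewrite (_ : _ + _ = t `^ (p - 1) * (e t * (X * t + lam * t `^ a))); last ring.
rewrite /ray_integrand normrM (ger0_norm (powR_ge0 _ _)) ler_wpM2l ?powR_ge0//.
rewrite normrM (ger0_norm (expR_ge0 _)) ler_pM ?expR_ge0// ?expA_le// ?(ltW t0)//.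
(* Since [cos kap = 0], the cosine is [- sin kap] times the sine of the remaining phase, hence
   bounded by [X * t + lam * t ^ a]. *)
rewrite /B pE mul0r add0r -addrA cosD ckap mul0r add0r normrN.
rewrite mulrC (le_trans (norm_mul_le _ (sin_max _)))// (le_trans (norm_sin_le _))//.
rewrite (le_trans (ler_normB _ _))// lerD//.
  rewrite (le_trans (norm_mul_le _ (cos_max _)))// ger0_norm// mulr_ge0//.
  exact: ltW.
rewrite (le_trans (norm_mul_le _ (sin_max _)))// ger0_norm//.
by rewrite mulr_ge0 ?powR_ge0// ltW.
Qed.

Let cvg_infty eta : eta \in `[u, v] ->
  t `^ p * (expR (A eta t) * sin (B eta t)) @[t --> +oo] --> 0.
Proof.
move=> euv.
(* [K] bounds [t ^ (p + 1) * e t], so the boundary term is at most [K / t]. *)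
pose K := ((p + 1) / (a * (lam * c))) `^ ((p + 1) / a).
have p1 : 0 < p + 1 by rewrite ltr_wpDl.
apply/cvgr0Pnorm_le => eps eps0; near=> t.
have t0 : 0 < t by near: t; exact: nbhs_pinfty_gt.
have Kt : K / eps <= t by near: t; apply: nbhs_pinfty_ge; rewrite num_real.
have := powR_expR_le p1 a0 lc0 t0; rewrite -/K.
rewrite powRD ?(gt_eqF t0) ?implybT// powRr1 ?(ltW t0)// => hK.
rewrite normrM (ger0_norm (powR_ge0 _ _)).
rewrite (@le_trans _ _ (t `^ p * e t))//.
  rewrite ler_wpM2l ?powR_ge0// (le_trans (norm_mul_le _ (sin_max _)))//.
  by rewrite ger0_norm ?expR_ge0// expA_le// ltW.
rewrite -(ler_pM2l t0) mulrA (mulrC t) (le_trans hK)//.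
by rewrite -ler_pdivrMr.
Unshelve. all: by end_near. Qed.

(** For [p = 0] the factor [t ^ p] is 1, and the boundary term keeps the value [sin kap] at the
    origin. *)
Let cvg_zero eta : t `^ p * (expR (A eta t) * sin (B eta t)) @[t --> 0^'+] -->
  (if p == 0 then sin kap else 0).
Proof.
have cvgid : (t : R) @[t --> 0^'+] --> (0 : R) by apply: cvg_at_right_filter; exact: cvg_id.
have cvga : t `^ a @[t --> 0^'+] --> (0 : R) by exact: powR_cvg0.
have cvgA : A eta t @[t --> 0^'+] --> (0 : R).
  rewrite /A [X in _ --> X](_ : _ = - (X * 0 * sin eta) - lam * 0 * cos (a * eta - psi)); last by ring.
  apply: cvgB; first apply: cvgN; apply: cvgM; first [exact: cvg_cst|apply: cvgM => //; exact: cvg_cst].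
have cvgB' : B eta t @[t --> 0^'+] --> (p * eta + kap).
  rewrite /B [X in _ --> X](_ : _ = p * eta + kap + X * 0 * cos eta - lam * 0 * sin (a * eta - psi)); last by ring.
  apply: cvgB; last by apply: cvgM; first [exact: cvg_cst|apply: cvgM => //; exact: cvg_cst].
  apply: cvgD; first exact: cvg_cst.
  by apply: cvgM; first [exact: cvg_cst|apply: cvgM => //; exact: cvg_cst].
have cexp : expR (A eta t) @[t --> 0^'+] --> (1 : R).
  by rewrite -expR0; apply: continuous_cvg => //; exact: continuous_expR.
have csin : sin (B eta t) @[t --> 0^'+] --> sin (p * eta + kap).
  by apply: continuous_cvg => //; exact: continuous_sin.
case: pkap => [p0'|[pE _]].
  rewrite gt_eqF// -[X in _ --> X](mul0r (1 * sin (p * eta + kap))).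
  by apply: cvgM; [exact: powR_cvg0|exact: cvgM].
rewrite ifT; last by rewrite pE.
have -> : sin kap = sin (p * eta + kap) by rewrite pE mul0r add0r.
rewrite (_ : (fun t => _) = fun t => expR (A eta t) * sin (B eta t)).
  by rewrite -[X in _ --> X]mul1r; exact: cvgM.
by apply/funext => t; rewrite pE powRr0 mul1r.
Qed.

(** By [der_t] the integral of [df eta] is the boundary value at the origin, the one at infinity
    being 0. It is the same for all [eta], so [Rintegral_increment] applies. *)
Lemma Rintegral_ray_rotation :
  \int[mu]_(t in `]0, +oo[) ray_integrand v t -
  \int[mu]_(t in `]0, +oo[) ray_integrand u t =
  (if p == 0 then sin kap else 0) * (v - u).
Proof.
apply: (@Rintegral_increment _ _ df g) => //.
- exact: integrable_ray_integrand.
- move=> eta euv.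
  have cont (t : R) : 0 < t -> {for t, continuous (df eta)}.
    by move=> t0; apply: has_derive_continuous; rewrite /df /dA /dB /A /B; der.
  have intdf : mu.-integrable `]0, +oo[ (EFin \o df eta).
    by apply: (@integrable_pos_dominated _ _ g) => // t; exact: df_le.
  have -> : \int[mu]_(t in `]0, +oo[) df eta t =
      - \int[mu]_(t in `]0, +oo[) (- df eta t).
    under [in RHS]eq_Rintegral do rewrite -mulN1r.
    by rewrite RintegralZl// mulN1r opprK.
  rewrite (@Rintegral_pos_FTC _ _
      (fun t => t `^ p * (expR (A eta t) * sin (B eta t)))
      (if p == 0 then sin kap else 0) 0).
  + by rewrite sub0r opprK.
  + by move=> t t0; apply: continuousN; exact: cont.
  + by move=> t t0; exact: der_t.
  + apply: integrable_eq_pos (integrable_scale (-1) mI intdf) => t _.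
    by rewrite mulN1r.
  + exact: cvg_zero.
  + exact: cvg_infty.
Qed.

End rotation.

(** * Integrals evaluated on the axis of real exponent *)

Section axis.
Context {R : realType}.
Local Notation mu := (@lebesgue_measure R).
Implicit Types lam a psi q kap : R.

Let pihalf_gt0 : 0 < pi / 2 :> R.
Proof. by rewrite divr_gt0// pi_gt0. Qed.

(** At the angle [psi / a] the exponent is real. On the way from 0, [|a * eta - psi| <= |psi|] keeps
    the cosine above [cos psi]. The sign of [psi] decides the order of the two end points. *)
Let rotation_to_axis lam a psi p kap : 0 < lam -> 0 < a -> 0 <= p ->
  0 < p \/ p = 0 /\ cos kap = 0 -> `|psi| < pi / 2 ->
  \int[mu]_(t in `]0, +oo[) ray_integrand lam 0 a p psi kap (psi / a) t -
  \int[mu]_(t in `]0, +oo[) ray_integrand lam 0 a p psi kap 0 t =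
  (if p == 0 then sin kap else 0) * (psi / a).
Proof.
move=> lam0 a0 p0 pkap psi_lt.
have cospsi : 0 < cos psi.
  by rewrite -cos_norm cos_gt0_pihalf// psi_lt andbT (lt_le_trans _ (normr_ge0 _))// oppr_lt0.
have cosc (eta : R) : 0 <= eta * psi -> `|a * eta| <= `|psi| -> cos psi <= cos (a * eta - psi).
  move=> epsi aeta; apply: cos_le_abs; last by have := pi_gt0 R; lra.
  have [psi0|psi0] := leP 0 psi.
    move: aeta; rewrite (ger0_norm psi0).
    have [->|psi_neq0] := eqVneq psi 0.
      by rewrite normr_le0 => /eqP ->; rewrite subr0 normr0.
    have eta0 : 0 <= eta by rewrite -(@pmulr_lge0 _ psi)// lt_neqAle eq_sym psi_neq0.
    have ae0 : 0 <= a * eta by rewrite mulr_ge0// ltW.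
    by rewrite (ger0_norm ae0) => h; rewrite ler_norml; apply/andP; split; lra.
  have eta0 : eta <= 0 by rewrite -(@nmulr_lge0 _ psi).
  have ae0 : a * eta <= 0 by rewrite mulr_ge0_le0// ltW.
  move: aeta; rewrite (ltr0_norm psi0) (ler0_norm ae0) => h.
  by rewrite ler_norml; apply/andP; split; lra.
have abs_le (eta : R) : eta \in `[0, psi / a] \/ eta \in `[psi / a, 0] ->
    0 <= eta * psi /\ `|a * eta| <= `|psi|.
  have aK : a * (psi / a) = psi by field; rewrite gt_eqF.
  rewrite !in_itv/=; case=> /andP[h1 h2].
    have psi0 : 0 <= psi by rewrite -aK mulr_ge0 ?(ltW a0) ?(le_trans h1).
    split; first exact: mulr_ge0.
    rewrite !ger0_norm ?mulr_ge0 ?(ltW a0)//.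
    by rewrite -[leRHS]aK ler_pM2l.
  have psi0 : psi <= 0 by rewrite -aK mulr_ge0_le0 ?(ltW a0) ?(le_trans h1).
  split; first exact: mulr_le0.
  rewrite !ler0_norm ?mulr_ge0_le0 ?(ltW a0)//.
  by rewrite lerN2 -[leLHS]aK ler_pM2l.
have [psi0|psi0] := leP 0 (psi / a).
  rewrite (@Rintegral_ray_rotation _ lam 0 a p psi kap lam0 _ a0 p0 0 (psi / a) (cos psi))//.
  - by rewrite subr0.
  - by move=> eta h; have [] := abs_le eta (or_introl h); exact: cosc.
rewrite -opprB (@Rintegral_ray_rotation _ lam 0 a p psi kap lam0 _ a0 p0 (psi / a) 0 (cos psi))//.
- by rewrite sub0r mulrN opprK.
- exact: ltW.
- by move=> eta h; have [] := abs_le eta (or_intror h); exact: cosc.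
Qed.

(** For [0 < q] there is no boundary term, and on the axis the phase is the constant
    [q * (psi / a) + kap], which leaves the integral. *)
Lemma Rintegral_powR_expR_cos lam a psi q kap : 0 < lam -> 0 < a -> 0 < q ->
  `|psi| < pi / 2 ->
  \int[mu]_(t in `]0, +oo[) (t `^ (q - 1) *
    (expR (- (lam * t `^ a * cos psi)) * cos (kap + lam * t `^ a * sin psi))) =
  cos (q * (psi / a) + kap) *
  \int[mu]_(t in `]0, +oo[) (t `^ (q - 1) * expR (- (lam * t `^ a))).
Proof.
move=> lam0 a0 q0 psi_lt.
have := rotation_to_axis lam0 a0 (ltW q0) (or_introl q0) psi_lt (kap := kap).
rewrite gt_eqF// mul0r => /eqP; rewrite subr_eq0 => /eqP eqK.
rewrite -[RHS]mulrC -RintegralZr//; last exact: integrable_powR_expR.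
have aK : a * (psi / a) = psi by field; rewrite gt_eqF.
transitivity (\int[mu]_(t in `]0, +oo[) ray_integrand lam 0 a q psi kap 0 t).
  apply: Rintegral_eq_pos => t t0; rewrite /ray_integrand.
  rewrite !mulr0 !mul0r oppr0 !sub0r cosN sinN add0r addr0.
  by rewrite mulrN opprK.
rewrite -eqK; apply: Rintegral_eq_pos => t t0; rewrite /ray_integrand.
rewrite aK subrr cos0 sin0 !(mulr1, mulr0, mul0r, oppr0, sub0r, add0r, addr0, subr0).
by rewrite mulrA.
Qed.

(** The case [p = 0], [kap = - pi / 2]: on the axis the integrand vanishes, and the value comes from
    the boundary term alone. *)
Lemma Rintegral_expR_sin_div lam a psi : 0 < lam -> 0 < a -> `|psi| < pi / 2 ->
  \int[mu]_(t in `]0, +oo[) (t^-1 *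
    (expR (- (lam * t `^ a * cos psi)) * sin (lam * t `^ a * sin psi))) = psi / a.
Proof.
move=> lam0 a0 psi_lt.
have ckap : 0 = 0 :> R /\ cos (- (pi / 2)) = 0 :> R by rewrite cosN cos_pihalf.
have := rotation_to_axis lam0 a0 (lexx 0) (or_intror ckap) psi_lt.
rewrite eqxx sinN sin_pihalf mulN1r.
have aK : a * (psi / a) = psi by field; rewrite gt_eqF.
rewrite (@Rintegral_eq_pos _ (ray_integrand _ _ _ _ _ _ (psi / a)) (fun=> 0)); last first.
  move=> t t0; rewrite /ray_integrand aK subrr sin0 !(mulr0, mul0r, sub0r, oppr0, add0r, addr0).
  by rewrite cosN cos_pihalf !mulr0.
rewrite Rintegral_cst// mul0r sub0r => /oppr_inj <-.
apply: Rintegral_eq_pos => t t0; rewrite /ray_integrand.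
rewrite sub0r powR_inv1 ?(ltW t0)// !(mulr0, mul0r, sub0r, oppr0, addr0) cosN sinN.
rewrite mulrN opprK; congr (_ * (_ * _)).
by rewrite addrC cosBpihalf.
Qed.

(** The integral of [exp (i * Y * z) dz] along the ray of angle [eta] is [i / Y], with real part 0.
    It is obtained from the power integral with [a = 1], [lam = Y] and [psi = pi / 2 - eta]. *)
Lemma Rintegral_exp_cos_shift (Y eta : R) : 0 < Y -> 0 < eta < pi / 2 ->
  \int[mu]_(t in `]0, +oo[) (expR (- (Y * t * sin eta)) * cos (eta + Y * t * cos eta)) = 0.
Proof.
move=> Y0 /andP[e0 e1].
have pe : `|pi / 2 - eta| < pi / 2 by rewrite ger0_norm; lra.
have := Rintegral_powR_expR_cos eta Y0 ltr01 ltr01 pe.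
rewrite divr1 mul1r subrK cos_pihalf mul0r; set I := Rintegral _ _ _ => I0.
rewrite -[RHS]I0 /I.
apply: Rintegral_eq_pos => t t0.
rewrite subrr powRr0 mul1r powRr1 ?(ltW t0)//.
by rewrite cosB sinB cos_pihalf sin_pihalf !(mul0r, mul1r, add0r, subr0).
Qed.

(** Dirichlet's integral moved to a ray: the same [psi = pi / 2 - eta] in the case [p = 0]. *)
Lemma Rintegral_exp_sin_div (Y eta : R) : 0 < Y -> 0 < eta < pi / 2 ->
  \int[mu]_(t in `]0, +oo[) (t^-1 * (expR (- (Y * t * sin eta)) * sin (Y * t * cos eta))) =
  pi / 2 - eta.
Proof.
move=> Y0 /andP[e0 e1].
have pe : `|pi / 2 - eta| < pi / 2 by rewrite ger0_norm; lra.
have := Rintegral_expR_sin_div Y0 ltr01 pe.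
rewrite divr1 => <-.
apply: Rintegral_eq_pos => t t0; rewrite powRr1 ?(ltW t0)//.
by rewrite cosB sinB cos_pihalf sin_pihalf !(mul0r, mul1r, add0r, subr0).
Qed.

End axis.

(** * The inversion formula *)

Section inversion.
Context {R : realType}.
Local Notation mu := (@lebesgue_measure R).
Variables a psi : R.
Hypotheses (a0 : 0 < a) (a2 : a <= 2) (psi_lt : `|psi| < pi / 2).

(** [Y] stands for [- x]. The integrand is the imaginary part of [exp (i * Y * t) / t] times the
    characteristic function at [t]; [fourier_cos] takes the real part without the division. *)
Definition gil_pelaez (Y : R) := \int[mu]_(t in `]0, +oo[)
  (t^-1 * (expR (- (t `^ a * cos psi)) * sin (Y * t + t `^ a * sin psi))).

Definition fourier_cos (Y : R) := \int[mu]_(t in `]0, +oo[)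
  (expR (- (t `^ a * cos psi)) * cos (Y * t + t `^ a * sin psi)).

Lemma cos_arg_gt0 : 0 < cos psi.
Proof.
rewrite -cos_norm cos_gt0_pihalf// psi_lt andbT (lt_le_trans _ (normr_ge0 _))//.
by rewrite oppr_lt0 divr_gt0// pi_gt0.
Qed.

Let e t := expR (- (t `^ a * cos psi)).

Let int_e q : 0 < q -> mu.-integrable `]0, +oo[ (EFin \o (fun t => t `^ (q - 1) * e t)).
Proof.
move=> q0; apply: integrable_eq_pos (integrable_powR_expR q0 a0 cos_arg_gt0) => t _.
by rewrite /e (mulrC (cos psi)).
Qed.

Let mI : measurable (`]0, +oo[%classic : set (measurableTypeR R)).
Proof. exact: measurable_itv. Qed.

(** The bound [|sin s| <= |s|] compensates [t ^ (- 1)]; the exponent [1 - 1] in the majorant keeps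
    the form of [int_e]. *)
Lemma integrable_gil_pelaez Y : mu.-integrable `]0, +oo[ (EFin \o (fun t =>
  t^-1 * (expR (- (t `^ a * cos psi)) * sin (Y * t + t `^ a * sin psi)))).
Proof.
apply: (@integrable_pos_dominated _ _
    (fun t => `|Y| * (t `^ (1 - 1) * e t) + t `^ (a - 1) * e t)).
- move=> t t0; apply: has_derive_continuous; der => //.
  by rewrite gt_eqF.
- move=> t t0; rewrite -/(e t) subrr powRr0 mul1r.
  have -> : t `^ (a - 1) = t^-1 * t `^ a.
    by rewrite powRB ?(gt_eqF t0) ?implybT// powRr1 ?(ltW t0)// mulrC.
  have -> : `|Y| * e t + t^-1 * t `^ a * e t = t^-1 * (e t * (`|Y| * t + t `^ a)).
    by field; rewrite gt_eqF.
  rewrite normrM gtr0_norm ?invr_gt0// ler_pM2l ?invr_gt0//.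
  rewrite normrM gtr0_norm ?expR_gt0// ler_pM2l ?expR_gt0//.
  rewrite (le_trans (norm_sin_le _))// (le_trans (ler_normD _ _))// lerD//.
    by rewrite normrM (gtr0_norm t0).
  by rewrite (le_trans (norm_mul_le _ (sin_max _)))// ger0_norm ?powR_ge0.
- apply: integrable_add => //; last exact: int_e.
  by apply: integrable_scale => //; exact: int_e.
Qed.

Let int_fourier (h : R -> R) : (forall t : R, 0 < t -> {for t, continuous h}) ->
  (forall t, `|h t| <= 1) ->
  mu.-integrable `]0, +oo[ (EFin \o (fun t => e t * h t)).
Proof.
move=> ch h1; apply: (@integrable_pos_dominated _ _ (fun t => t `^ (1 - 1) * e t)).
- move=> t t0; apply: continuousM; last exact: ch.
  by apply: has_derive_continuous; rewrite /e; der.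
- by move=> t _; rewrite subrr powRr0 mul1r (le_trans (norm_mul_le _ _))// ger0_norm ?expR_ge0.
- exact: int_e.
Qed.

Lemma integrable_fourier_cos Y : mu.-integrable `]0, +oo[ (EFin \o (fun t =>
  expR (- (t `^ a * cos psi)) * cos (Y * t + t `^ a * sin psi))).
Proof.
apply: int_fourier => // [t t0|t]; last exact: cos_max.
by apply: has_derive_continuous; der.
Qed.

(** Differentiation in [Y] cancels [t ^ (- 1)] and leaves [e] as a majorant uniform in [Y]. *)
Lemma has_derive_gil_pelaez Y : has_derive gil_pelaez Y (fourier_cos Y).
Proof.
apply: (@has_derive_Rintegral _ _
   (fun y t => e t * cos (y * t + t `^ a * sin psi))
   (fun t => t `^ (1 - 1) * e t) (Y - 1) (Y + 1)).
- by move=> y _; exact: integrable_gil_pelaez.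
- move=> y _ t t0; apply: has_derive_eq; first by der.
  by rewrite /= -/(e t); field; rewrite gt_eqF.
- by move=> t; rewrite mulr_ge0 ?powR_ge0 ?expR_ge0.
- exact: int_e.
- move=> y _ t t0; rewrite subrr powRr0 mul1r (le_trans (norm_mul_le _ (cos_max _)))//.
  by rewrite ger0_norm ?expR_ge0.
- by rewrite in_itv/=; apply/andP; split; lra.
Qed.

Lemma continuous_fourier_cos : continuous fourier_cos.
Proof.
move=> Y; have : has_derive fourier_cos Y (\int[mu]_(t in `]0, +oo[)
    (- (t * (e t * sin (Y * t + t `^ a * sin psi))))); last exact: has_derive_continuous.
apply: (@has_derive_Rintegral _ _
   (fun y t => - (t * (e t * sin (y * t + t `^ a * sin psi))))
   (fun t => t `^ (2 - 1) * e t) (Y - 1) (Y + 1)).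
- by move=> y _; exact: integrable_fourier_cos.
- move=> y _ t t0; apply: has_derive_eq; first by der.
  by rewrite /= -/(e t); ring.
- by move=> t; rewrite mulr_ge0 ?powR_ge0 ?expR_ge0.
- exact: int_e.
- move=> y _ t t0; rewrite (_ : 2 - 1 = 1); last by ring.
  rewrite powRr1 ?(ltW t0)// normrN normrM (gtr0_norm t0) ler_pM2l//.
  by rewrite (le_trans (norm_mul_le _ (sin_max _)))// ger0_norm ?expR_ge0.
- by rewrite in_itv/=; apply/andP; split; lra.
Qed.

Lemma gil_pelaez0 : gil_pelaez 0 = psi / a.
Proof.
rewrite -(Rintegral_expR_sin_div ltr01 a0 psi_lt); apply: Rintegral_eq_pos => t t0.
by rewrite mul0r add0r mul1r.
Qed.

(** As [a <= 2], an angle up to [eta0] adds to [|psi|] at most half of the gap [pi / 2 - |psi|]; the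
    total is [bd], still below [pi / 2]. *)
Let bd := (pi / 2 + `|psi|) / 2.
Let eta0 := (pi / 2 - `|psi|) / 4.

Let eta0_itv : 0 < eta0 < pi / 2.
Proof. by rewrite /eta0; have := psi_lt; have := normr_ge0 psi; lra. Qed.

Let bd_gt0 : 0 < cos bd.
Proof. by apply: cos_gt0_pihalf; rewrite /bd; have := psi_lt; have := normr_ge0 psi; lra. Qed.

Let cos_ge_bd : {in `[0, eta0], forall eta : R, cos bd <= cos (a * eta - psi)}.
Proof.
move=> eta; rewrite in_itv/= => /andP[e0 e1]; have p0 := normr_ge0 psi; have pl := psi_lt.
have bd0 : 0 <= bd by rewrite /bd; lra.
apply: cos_le_abs; rewrite (ger0_norm bd0); last by rewrite /bd; lra.
rewrite (le_trans (ler_normB _ _))// ger0_norm ?mulr_ge0 ?(ltW a0)//.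
have : a * eta <= 2 * eta0 by rewrite ler_pM ?(ltW a0).
by rewrite /bd /eta0; lra.
Qed.

Let sin_ge0 Y : 0 <= Y -> {in `[0, eta0], forall eta : R, 0 <= Y * sin eta}.
Proof.
move=> Y0 eta; rewrite in_itv/= => /andP[e0 e1]; rewrite mulr_ge0// sin_ge0_pi// e0/=.
by move/andP: eta0_itv => [_ ?]; have := pi_gt0 R; lra.
Qed.

Let sig_gt0 : 0 < sin eta0.
Proof.
by apply: sin_gt0_pihalf.
Qed.

(** On the ray of angle [eta0] the factor [exp (i * Y * z)] decays. By [damped_cos], replacing the
    integrand by this factor alone costs [2 * t ^ (p + a - 1) * exp (- Y * t * sin eta0)], which
    integrates to a Gamma value. *)
Let rotated_bound p kap Y : 0 < Y -> 0 <= p -> 0 < p \/ p = 0 /\ cos kap = 0 ->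
  `| \int[mu]_(t in `]0, +oo[) ray_integrand 1 Y a p psi kap eta0 t -
     \int[mu]_(t in `]0, +oo[) (t `^ (p - 1) *
       (expR (- (Y * t * sin eta0)) * cos (p * eta0 + kap + Y * t * cos eta0)))|
  <= 2 * (Gamma (p + a) / (Y * sin eta0) `^ (p + a)).
Proof.
move=> Y0 p0 pkap; set r := fun t => ray_integrand 1 Y a p psi kap eta0 t.
set w := fun t => t `^ (p - 1) * _.
have pa0 : 0 < p + a by rewrite ltr_wpDl.
have eta0P : eta0 \in `[0, eta0] by rewrite in_itv/= lexx ltW//; case/andP: eta0_itv.
have intr : mu.-integrable `]0, +oo[ (EFin \o r).
  by apply: (integrable_ray_integrand _ _ _ _ bd_gt0 cos_ge_bd (sin_ge0 (ltW Y0))) => //; exact: ltW.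
pose g t := 2 * (t `^ (p + a - 1) * expR (- (Y * sin eta0 * t `^ 1))).
have Ysig : 0 < Y * sin eta0 by rewrite mulr_gt0.
have intg : mu.-integrable `]0, +oo[ (EFin \o g).
  by apply: integrable_scale => //; exact: integrable_powR_expR.
have rw_le (t : R) : 0 < t -> `|r t - w t| <= g t.
  move=> t0; rewrite /r /w /g /ray_integrand mul1r powRr1 ?(ltW t0)//.
  set x := p * eta0 + kap + Y * t * cos eta0.
  have -> : t `^ (p + a - 1) = t `^ (p - 1) * t `^ a.
    by rewrite -powRD ?(gt_eqF t0) ?implybT//; congr powR; ring.
  rewrite expRD (_ : Y * sin eta0 * t = Y * t * sin eta0); last ring.
  set E := expR _; set P := t `^ (p - 1); set u := t `^ a.
  rewrite (_ : _ - _ = P * E * (expR (- (u * cos (a * eta0 - psi))) *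
    cos (x - u * sin (a * eta0 - psi)) - cos x)); last ring.
  rewrite (_ : 2 * _ = P * E * (2 * u)); last ring.
  have PE : 0 <= P * E by rewrite mulr_ge0 ?powR_ge0 ?expR_ge0.
  rewrite normrM (ger0_norm PE) ler_wpM2l// damped_cos ?powR_ge0 ?sin_max//.
  by rewrite cos_le1 andbT (le_trans (ltW bd_gt0))// cos_ge_bd.
have intrw : mu.-integrable `]0, +oo[ (EFin \o (fun t => r t - w t)).
  apply: (integrable_pos_dominated _ rw_le intg) => t t0.
  by apply: has_derive_continuous; rewrite /r /w /ray_integrand; der.
have intw : mu.-integrable `]0, +oo[ (EFin \o w).
  by apply: integrable_eq_pos (integrable_sub mI intr intrw) => t _; rewrite opprB addrC subrK.
rewrite -RintegralB// (le_trans (norm_Rintegral_pos_le intrw intg rw_le))//.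
rewrite RintegralZl//; last exact: integrable_powR_expR.
have := Gamma_powR_expR pa0 ltr01 Ysig.
rewrite divr1 mul1r => ->.
by rewrite mulrAC divff ?mul1r// gt_eqF// powR_gt0.
Qed.

(** For [p = 1] the rotation changes nothing and the pure exponential contributes 0, so only the
    error of [rotated_bound] remains. *)
Lemma fourier_cos_decay : exists2 K, 0 <= K &
  forall Y : R, 0 < Y -> `|fourier_cos Y| <= K * Y `^ (- (1 + a)).
Proof.
exists (2 * (Gamma (1 + a) * (sin eta0) `^ (- (1 + a)))).
  rewrite !mulr_ge0 ?powR_ge0//; apply: Rintegral_ge0 => t _.
  by rewrite mulr_ge0 ?powR_ge0 ?expR_ge0.
move=> Y Y0; have eta0_ge0 : 0 <= eta0 by case/andP: eta0_itv => /ltW.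
have := @Rintegral_ray_rotation R 1 Y a 1 psi 0 ltr01 (ltW Y0) a0 ler01 0 eta0 (cos bd)
  eta0_ge0 bd_gt0 cos_ge_bd (sin_ge0 (ltW Y0)) (or_introl ltr01).
rewrite oner_eq0 mul0r => /eqP; rewrite subr_eq0 => /eqP rotE.
have pureE : \int[mu]_(t in `]0, +oo[) (t `^ (1 - 1) *
    (expR (- (Y * t * sin eta0)) * cos (1 * eta0 + 0 + Y * t * cos eta0))) = 0.
  rewrite -[RHS](Rintegral_exp_cos_shift Y0 eta0_itv).
  by apply: Rintegral_eq_pos => t _; rewrite subrr powRr0 !mul1r addr0.
have -> : fourier_cos Y = \int[mu]_(t in `]0, +oo[) ray_integrand 1 Y a 1 psi 0 eta0 t.
  rewrite rotE; apply: Rintegral_eq_pos => t t0; rewrite /ray_integrand.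
  rewrite subrr powRr0 sin0 cos0 !(mul1r, mulr0, mulr1, sub0r, add0r, oppr0, addr0).
  by rewrite cosN sinN mulrN opprK.
have := rotated_bound Y0 ler01 (or_introl ltr01) (kap := 0).
rewrite pureE subr0 => /le_trans; apply.
by rewrite powRM ?(ltW Y0) ?(ltW sig_gt0)// !powRN invfM !mulrA mulrAC.
Qed.

(** For [p = 0], [kap = - pi / 2] the rotation subtracts [eta0] and the pure exponential contributes
    [pi / 2 - eta0]; the angle cancels, with an error of order [Y ^ (- a)]. *)
Lemma cvg_gil_pelaez : gil_pelaez Y @[Y --> +oo] --> pi / 2.
Proof.
have ckap : 0 = 0 :> R /\ cos (- (pi / 2)) = 0 :> R by rewrite cosN cos_pihalf.
have G0 : 0 <= Gamma a.
  by apply: Rintegral_ge0 => t _; rewrite mulr_ge0 ?powR_ge0 ?expR_ge0.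
have bound (Y : R) : 0 < Y -> `|pi / 2 - gil_pelaez Y| <= 2 * (Gamma a / (Y * sin eta0) `^ a).
  move=> Y0; have eta0_ge0 : 0 <= eta0 by case/andP: eta0_itv => /ltW.
  have := @Rintegral_ray_rotation R 1 Y a 0 psi (- (pi / 2)) ltr01 (ltW Y0) a0 (lexx _) 0 eta0 (cos bd)
    eta0_ge0 bd_gt0 cos_ge_bd (sin_ge0 (ltW Y0)) (or_intror ckap).
  rewrite eqxx sinN sin_pihalf subr0 mulN1r => /eqP; rewrite subr_eq => /eqP rotE.
  have pureE : \int[mu]_(t in `]0, +oo[) (t `^ (0 - 1) *
      (expR (- (Y * t * sin eta0)) * cos (0 * eta0 + - (pi / 2) + Y * t * cos eta0))) =
      pi / 2 - eta0.
    rewrite -[RHS](Rintegral_exp_sin_div Y0 eta0_itv).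
    apply: Rintegral_eq_pos => t t0; rewrite sub0r powR_inv1 ?(ltW t0)// mul0r add0r addrC.
    by rewrite cosBpihalf.
  have gpE : gil_pelaez Y = \int[mu]_(t in `]0, +oo[) ray_integrand 1 Y a 0 psi (- (pi / 2)) 0 t.
    apply: Rintegral_eq_pos => t t0; rewrite /ray_integrand.
    rewrite sub0r powR_inv1 ?(ltW t0)// sin0 cos0 !(mul1r, mul0r, mulr0, mulr1, sub0r, add0r, oppr0, addr0).
    rewrite cosN sinN mulrN opprK -addrA [- (pi / 2) + _]addrC.
    by rewrite cosBpihalf.
  have := rotated_bound Y0 (lexx 0) (or_intror ckap).
  rewrite pureE rotE -gpE add0r distrC.
  by rewrite (_ : pi / 2 - eta0 - (- eta0 + gil_pelaez Y) = pi / 2 - gil_pelaez Y); last ring.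
apply/cvgrPdist_le => /= eps eps0; near=> Y.
have Y0 : 0 < Y by near: Y; exact: nbhs_pinfty_gt.
rewrite (le_trans (bound _ Y0))//.
(* The threshold is the [Y] at which the error bound equals [eps]. *)
have : (2 * Gamma a / eps) `^ a^-1 / sin eta0 <= Y.
  by near: Y; apply: nbhs_pinfty_ge; rewrite num_real.
rewrite ler_pdivrMr// => h.
have E0 : 0 <= 2 * Gamma a / eps by rewrite divr_ge0 ?mulr_ge0// ltW.
have /(ge0_ler_powR (ltW a0)) := h.
rewrite !nnegrE powR_ge0 mulr_ge0 ?(ltW Y0) ?(ltW sig_gt0)// => /(_ isT isT).
rewrite -powRrM mulVf ?gt_eqF// powRr1// ler_pdivrMr// => h2.
have P0 : 0 < (Y * sin eta0) `^ a by apply: powR_gt0; exact: mulr_gt0.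
by rewrite mulrA ler_pdivrMr// [eps * _]mulrC.
Unshelve. all: by end_near. Qed.

(** The decay of order [1 + a] covers the part left of -1, continuity the rest. *)
Lemma integrable_fourier_cosN x :
  mu.-integrable `]-oo, x] (EFin \o (fun y => fourier_cos (- y))).
Proof.
have cD y : {for y, continuous (fun y => fourier_cos (- y))}.
  by apply: continuous_comp; [exact: opp_continuous|exact: continuous_fourier_cos].
have intNy : mu.-integrable `]-oo, -1] (EFin \o (fun y => fourier_cos (- y))).
  have [K K0 KD] := fourier_cos_decay.
  apply: (@integrable_dominated _ _ _ (fun y => K * (- y) `^ (- (1 + a)))).
  - exact: measurable_itv.
  - by apply: measurable_funTS; exact: continuous_measurable_fun.
  - by move=> y /=; rewrite in_itv/= => y1; apply: KD; lra.
  (* An explicit primitive of the majorant, bounded by [K / a] because [1 <= - y]. *)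
  - apply: (@integrable_Ny_primitive _ _ (fun y => K / a * (- y) `^ (- a)) _ (K / a)).
    + by move=> y y1; apply: has_derive_continuous; der; lra.
    + by move=> y y1; rewrite mulr_ge0 ?powR_ge0.
    + move=> y y1; apply: has_derive_eq; first by der; lra.
      rewrite (_ : - a - 1 = - (1 + a)); last ring.
      by field; rewrite gt_eqF.
    + move=> y y1; have Ka0 : 0 <= K / a by rewrite divr_ge0// ltW.
      rewrite normrM (ger0_norm Ka0) (ger0_norm (powR_ge0 _ _)) ler_piMr//.
      have y0 : 0 < (- y) `^ a by apply: powR_gt0; lra.
      rewrite powRN invf_le1// -[leLHS](_ : 1 `^ a = 1); last by rewrite powR1.
      by rewrite ge0_ler_powR ?nnegrE ?(ltW a0)//; lra.
have [x1|x1] := leP x (- 1).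
  apply: (@integrableS _ _ _ mu _ _ _ (measurable_itv _) (measurable_itv _) _ intNy).
  by apply: subset_itvl; rewrite bnd_simp.
have intc : mu.-integrable `[-1, x] (EFin \o (fun y => fourier_cos (- y))).
  by apply: continuous_itv_integrable => y _.
have -> : `]-oo, x]%classic = `]-oo, -1] `|` `]-1, x].
  apply/seteqP; split => y /=; rewrite !in_itv/=.
    by move=> yx; have [y1|y1] := leP y (- 1); [left|right].
  move=> [y1|/andP[_]//].
  by rewrite (le_trans y1)// ltW.
apply: integrable_setU => //.
apply: (@integrableS _ _ _ mu _ _ _ (measurable_itv _) (measurable_itv _) _ intc).
exact: subset_itv_oc_cc.
Qed.

(** The primitive [- gil_pelaez (- y)] tends to [- pi / 2] at [-oo]. *)
Lemma Rintegral_fourier_cosN x :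
  \int[mu]_(y in `]-oo, x]) (fourier_cos (- y) / pi) = 1 / 2 - gil_pelaez (- x) / pi.
Proof.
rewrite RintegralZr//; last exact: integrable_fourier_cosN.
rewrite (@Rintegral_Ny_FTC _ _ (fun y => - gil_pelaez (- y)) _ (- (pi / 2))).
- have pi0 : pi != 0 :> R by rewrite gt_eqF// pi_gt0.
  by move: (@pi R) pi0 => p p0; field.
- move=> y _; apply: continuous_comp; first exact: opp_continuous.
  exact: continuous_fourier_cos.
- move=> y _; apply: has_derive_eq.
    apply: has_deriveN; apply: (@has_derive_comp _ gil_pelaez).
      exact: has_derive_gil_pelaez.
    exact: has_deriveN (has_derive_id y).
  by rewrite mulrN1 opprK.
- exact: integrable_fourier_cosN.
- by apply: cvgN; apply/cvgNy_compNP; rewrite /comp; under eq_fun do rewrite opprK; exact: cvg_gil_pelaez.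
Qed.

End inversion.

(** * Density and distribution function of the stable law *)

Section stable_density.
Local Open Scope complex_scope.
Context {R : realType}.
Local Notation mu := (@lebesgue_measure R).

Lemma Rintegral_even (k : R -> R) : measurable_fun setT k ->
  mu.-integrable `]0, +oo[ (EFin \o k) ->
  \int[mu]_(t in [set: R]) k `|t| = 2 * \int[mu]_(t in `]0, +oo[) k t.
Proof.
move=> mk intk.
have mkn : measurable_fun setT (fun t : R => k `|t|) by exact: measurableT_comp.
have [||intN eN] := @Rintegral_reflect _ (fun t : R => k `|t|) => //.
  by apply: integrable_eq_pos intk => t t0 /=; rewrite normrN gtr0_norm.
have intP : mu.-integrable `]0, +oo[ (EFin \o (fun t : R => k `|t|)).
  by apply: integrable_eq_pos intk => t t0; rewrite gtr0_norm.
have int0 : mu.-integrable [set 0] (EFin \o (fun t : R => k `|t|)).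
  apply: null_set_integrable; [exact: measurable_set1| |exact: lebesgue_measure_set1].
  exact/measurable_EFinP/measurable_funTS.
have int0P : mu.-integrable `[0, +oo[ (EFin \o (fun t : R => k `|t|)).
  have -> : `[0, +oo[%classic = [set 0] `|` `]0, +oo[ :> set R.
    by rewrite setU1itv.
  by apply: integrable_setU.
have TE : [set: R] = `]-oo, 0[ `|` `[0, +oo[.
  apply/seteqP; split=> // t _ /=; rewrite !in_itv/= andbT.
  by have [|] := ltP t 0; [left|right].
rewrite TE Rintegral_setU//; first last.
- by apply/disj_setPS => t /= []; rewrite !in_itv/= andbT; case: ltP.
- exact: integrable_setU.
rewrite -Rintegral_itv_obnd_cbnd// eN mulr2n mulrDl mul1r; congr (_ + _).
  by apply: Rintegral_eq_pos => t t0; rewrite normrN gtr0_norm.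
by apply: Rintegral_eq_pos => t t0; rewrite gtr0_norm.
Qed.

Variables alpha theta : R.
Let psi := pi / 2 * alpha * theta.
Hypotheses (a0 : 0 < alpha) (a2 : alpha <= 2) (psi_lt : `|psi| < pi / 2).

(** By Hermitian symmetry the real part of the inversion integrand depends on [|t|] only, so the
    integral over the line is twice that over the half-line. *)
Lemma stable_densityE x : stable_density alpha theta x = fourier_cos alpha psi (- x) / pi.
Proof.
pose k t := expR (- (t `^ alpha * cos psi)) * cos (- x * t + t `^ alpha * sin psi).
have intk := integrable_fourier_cos a0 psi_lt (- x).
have mk : measurable_fun setT k.
  have mp : measurable_fun setT (fun t : R => t `^ alpha) by exact: measurable_powR.
  apply: measurable_funM; apply: measurableT_comp => //.
  - by apply: measurableT_comp => //; exact: measurable_funM.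
  - by apply: continuous_measurable_fun; exact: continuous_cos.
  - by apply: measurable_funD; exact: measurable_funM.
have kE t : complex.Re (cexp (- 'i%C * (t * x)%:C) * stable_charfun alpha theta t)
    = k `|t|.
  rewrite /stable_charfun /cexp /=.
  rewrite !(mul0r, mulr0, sub0r, subr0, addr0, add0r, oppr0, mulN1r, mul1r, expR0).
  rewrite -/psi; set T := `|t| `^ alpha; set E := expR _; set b := T * _.
  rewrite (_ : _ - _ = E * cos (- (t * x) + - b)); last by rewrite cosD; ring.
  rewrite /k /E /b -/T {E b}.
  have [t0|t0|t0] := ltgtP t 0.
  - rewrite (ltr0_sg t0) (ltr0_norm t0) mulrN1 opprK mulrNN (mulrC x t).
    by rewrite -opprD cosN.
  - rewrite (gtr0_sg t0) (gtr0_norm t0) mulr1 cosN sinN mulrN opprK.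
    by rewrite mulNr (mulrC x t).
  - rewrite /T t0 normr0 powR0 ?gt_eqF//.
    by rewrite !(mul0r, mulr0, oppr0, addr0).
have scaleRe (r u v : R) : complex.Re (r%:C * (u +i* v)) = r * u.
  by rewrite /= mul0r subr0.
rewrite /stable_density /cintegral scaleRe.
under eq_Rintegral do rewrite kE.
rewrite Rintegral_even// -/(fourier_cos alpha psi (- x)).
have pi0 : pi != 0 :> R by rewrite gt_eqF// pi_gt0.
by move: (fourier_cos _ _ _) => F; move: (@pi R) pi0 => p p0; field.
Qed.

Lemma stable_cdfE x : stable_cdf alpha theta x = 1 / 2 - gil_pelaez alpha psi (- x) / pi.
Proof.
rewrite /stable_cdf -(Rintegral_fourier_cosN a0 a2 psi_lt x).
by apply: eq_Rintegral => y _; exact: stable_densityE.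
Qed.

End stable_density.

(** * Taylor's formula for the sine *)

Section sin_taylor.
Context {R : realType}.

(** On the positive side the power minus [g] has a nonnegative derivative, so the mean value theorem
    bounds [g]. Applying this to [g] and [- g] gives both signs, and reflection gives negative
    [y]. *)
Lemma norm_le_expn_derive (f df : R -> R) n : (forall z, has_derive f z (df z)) ->
  f 0 = 0 -> (forall z, `|df z| <= `|z| ^+ n / n`!%:R) ->
  forall y, `|f y| <= `|y| ^+ n.+1 / n.+1`!%:R.
Proof.
have factS : (n.+1)`!%:R = n.+1%:R * n`!%:R :> R by rewrite factS natrM.
have nf0 : n`!%:R != 0 :> R by rewrite pnatr_eq0 -lt0n fact_gt0.
have up (g dg : R -> R) y : (forall z, has_derive g z (dg z)) -> g 0 = 0 ->
    (forall z, `|dg z| <= `|z| ^+ n / n`!%:R) -> 0 <= y -> g y <= y ^+ n.+1 / n.+1`!%:R.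
  move=> gd g0 dg_le y0.
  pose h z := z ^+ n.+1 / n.+1`!%:R - g z; pose dh z := z ^+ n / n`!%:R - dg z.
  have hd z : has_derive h z (dh z).
    apply: has_derive_eq.
      refine (@has_deriveD _ _ _ _ _ _ _ _); first by der.
      refine (@has_deriveN _ _ _ _ _); exact: gd.
    by rewrite /dh factS /=; field; rewrite nf0 nat1r pnatr_eq0.
  have hd' z : z \in `]0, y[ -> is_derive z 1 h (dh z) by move=> _; exact: hd.
  have ch : {within `[0, y], continuous h}.
    by apply: continuous_in_subspaceT => z _; exact: has_derive_continuous.
  have [z] := MVT_segment y0 hd' ch.
  rewrite in_itv/= => /andP[z0 zy]; rewrite {1 2}/h g0 expr0n/= mul0r !subr0 => hE.
  rewrite -subr_ge0 hE mulr_ge0// /dh subr_ge0.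
  have := dg_le z; rewrite (ger0_norm z0) => dgz.
  by rewrite (le_trans (ler_norm _)).
have updn (g dg : R -> R) y : (forall z, has_derive g z (dg z)) -> g 0 = 0 ->
    (forall z, `|dg z| <= `|z| ^+ n / n`!%:R) -> 0 <= y -> `|g y| <= y ^+ n.+1 / n.+1`!%:R.
  move=> gd g0 dg_le y0; rewrite ler_norml (up _ _ _ gd)// andbT lerNl.
  apply: (up (fun z => - g z) (fun z => - dg z)) => //.
  - by move=> z; exact: has_deriveN.
  - by rewrite g0 oppr0.
  - by move=> z; rewrite normrN.
move=> fd f0 df_le y; have [y0|y0] := leP 0 y; first by rewrite [X in X ^+ _](ger0_norm y0); exact: (updn f df).
have yN0 : 0 <= - y by rewrite oppr_ge0 ltW.
rewrite -(opprK y) normrN [X in X ^+ _](ger0_norm yN0).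
apply: (updn (fun z => f (- z)) (fun z => - df (- z))).
- move=> z; apply: has_derive_eq.
    by apply: (@has_derive_comp _ f); [exact: fd|exact: has_deriveN (has_derive_id z)].
  by rewrite mulrN1.
- by rewrite oppr0.
- by move=> z; rewrite normrN (le_trans (df_le _))// normrN.
- exact: yN0.
Qed.

(** Induction on [n]: the derivative in [y] of the remainder is the remainder of the preceding order
    with [b - pi / 2] in place of [b]. *)
Lemma sin_taylor (b y : R) n :
  `|sin (b - y) - \sum_(0 <= k < n) y ^+ k / k`!%:R * sin (b - k%:R * (pi / 2))|
  <= `|y| ^+ n / n`!%:R.
Proof.
elim: n b y => [|n IHn] b y.
  by rewrite big_geq// subr0 expr0 fact0 divr1 sin_max.
pose f z := sin (b - z) - \sum_(0 <= k < n.+1) z ^+ k / k`!%:R * sin (b - k%:R * (pi / 2)).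
pose df z := sin (b - pi / 2 - z) -
  \sum_(0 <= k < n) z ^+ k / k`!%:R * sin (b - pi / 2 - k%:R * (pi / 2)).
apply: (@norm_le_expn_derive f df) => [z||z]; last exact: IHn.
- rewrite /f /df.
  have sumd m : has_derive (fun z => \sum_(0 <= k < m.+1) z ^+ k / k`!%:R * sin (b - k%:R * (pi / 2))) z
      (\sum_(0 <= k < m) z ^+ k / k`!%:R * sin (b - pi / 2 - k%:R * (pi / 2))).
    elim: m => [|m IHm].
      rewrite big_geq//; under eq_fun do rewrite big_nat1 expr0; exact: has_derive_cst.
    rewrite big_nat_recr//=; under eq_fun do rewrite big_nat_recr//=.
    apply: has_derive_eq.
      refine (@has_deriveD _ _ _ _ _ _ IHm _); by der.
    rewrite (_ : b - m.+1%:R * (pi / 2) = b - pi / 2 - m%:R * (pi / 2)); last first.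
      by rewrite -natr1; ring.
    have factS : (m.+1)`!%:R = m.+1%:R * m`!%:R :> R by rewrite factS natrM.
    have mf0 : m`!%:R != 0 :> R by rewrite pnatr_eq0 -lt0n fact_gt0.
    rewrite factS; congr (_ + _); move: (sin _) => s; field.
    by rewrite mf0 nat1r pnatr_eq0.
  apply: has_derive_eq.
    refine (@has_deriveD _ _ _ _ _ _ _ _); first by der.
    refine (@has_deriveN _ _ _ _ _); exact: sumd.
  by rewrite addrAC sinBpihalf; ring.
- rewrite /f subr0 big_nat_recl// expr0 fact0 divr1 mul1r mul0r subr0.
  rewrite big1 ?addr0 ?subrr// => k _.
  by rewrite expr0n/= mul0r mul0r.
Qed.

End sin_taylor.

(** * The expansion with remainder *)

Section Gamma_function.
Context {R : realType}.
Local Notation mu := (@lebesgue_measure R).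

Lemma integrable_Gamma (s : R) : 0 < s ->
  mu.-integrable `]0, +oo[ (EFin \o (fun t => t `^ (s - 1) * expR (- t))).
Proof.
move=> s0; apply: integrable_eq_pos (integrable_powR_expR s0 ltr01 ltr01) => t t0.
by rewrite mul1r powRr1// ltW.
Qed.

(** Integration by parts: [t ^ s * exp (- t)] vanishes at both ends. *)
Lemma GammaS (s : R) : 0 < s -> Gamma (s + 1) = s * Gamma s.
Proof.
move=> s0.
have mI : measurable (`]0, +oo[%classic : set (measurableTypeR R)) by exact: measurable_itv.
have s1 : 0 < s + 1 by rewrite ltr_wpDr.
have int1 := integrable_Gamma s1.
have int2 := integrable_scale s mI (integrable_Gamma s0).
apply/eqP; rewrite -subr_eq0 -opprB oppr_eq0; apply/eqP.
rewrite /Gamma -RintegralZl//; last exact: integrable_Gamma.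
rewrite -RintegralB//.
rewrite (@Rintegral_pos_FTC _ _ (fun t => t `^ s * expR (- t)) 0 0) ?subr0//.
- by move=> t t0; apply: has_derive_continuous; der.
- move=> t t0; apply: has_derive_eq; first by der.
  by rewrite addrK; ring.
- exact: integrable_sub.
- rewrite -[X in _ --> X](mul0r (expR (- 0))); apply: cvgM; first exact: powR_cvg0.
  apply: cvg_at_right_filter; apply: continuous_cvg; first exact: continuous_expR.
  by apply: cvgN; exact: cvg_id.
- pose K := ((s + 1) / (1 * 1)) `^ ((s + 1) / 1).
  apply/cvgr0Pnorm_le => eps eps0; near=> t.
  have t0 : 0 < t by near: t; exact: nbhs_pinfty_gt.
  have Kt : K / eps <= t by near: t; apply: nbhs_pinfty_ge; rewrite num_real.
  have := powR_expR_le s1 ltr01 ltr01 t0; rewrite -/K mul1r powRr1 ?(ltW t0)//.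
  rewrite powRD ?(gt_eqF t0) ?implybT// powRr1 ?(ltW t0)// => hK.
  rewrite ger0_norm ?mulr_ge0 ?powR_ge0 ?expR_ge0//.
  rewrite -(ler_pM2l t0) mulrA (mulrC t) (le_trans hK)//.
  by rewrite -ler_pdivrMr.
Unshelve. all: by end_near. Qed.

Lemma Gamma1 : Gamma 1 = 1 :> R.
Proof.
rewrite /Gamma (@Rintegral_pos_FTC _ _ (fun t => - expR (- t)) (- 1) 0).
- by rewrite opprK add0r.
- by move=> t t0; apply: has_derive_continuous; der.
- move=> t t0; apply: has_derive_eq; first by der.
  by rewrite subrr powRr0; ring.
- exact: integrable_Gamma.
- apply: cvgN; rewrite -expR0; apply: cvg_at_right_filter.
  apply: continuous_cvg; first exact: continuous_expR.
  by rewrite -[X in _ --> X]oppr0; apply: cvgN; exact: cvg_id.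
- rewrite -oppr0; apply: cvgN; exact: cvgr_expR.
Qed.

Lemma Gamma_nat n : Gamma (n.+1%:R) = n`!%:R :> R.
Proof.
elim: n => [|n IHn]; first by rewrite Gamma1.
by rewrite -natr1 GammaS// IHn factS natrM.
Qed.

End Gamma_function.

(** * Expansion of the distribution function at the origin *)

Section cdf_expansion.
Context {R : realType}.
Local Notation mu := (@lebesgue_measure R).

Lemma Rintegral_sum (h : nat -> R -> R) n :
  (forall k, mu.-integrable `]0, +oo[ (EFin \o h k)) ->
  mu.-integrable `]0, +oo[ (EFin \o (fun t => \sum_(0 <= k < n) h k t)) /\
  \int[mu]_(t in `]0, +oo[) (\sum_(0 <= k < n) h k t) =
  \sum_(0 <= k < n) \int[mu]_(t in `]0, +oo[) h k t.
Proof.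
move=> inth.
have mI : measurable (`]0, +oo[%classic : set (measurableTypeR R)) by exact: measurable_itv.
elim: n => [|n [IH1 IH2]].
  split; last by rewrite big_geq// (@Rintegral_eq_pos _ _ (fun=> 0)) ?Rintegral_cst ?mul0r// => t _; rewrite big_geq.
  apply: (@integrable_eq_pos _ (fun=> 0)) => [t _|]; first by rewrite big_geq.
  exact: integrable0.
split.
  apply: integrable_eq_pos (integrable_add mI IH1 (inth n)) => t _.
  by rewrite big_nat_recr.
rewrite big_nat_recr//= -IH2 -RintegralD//.
by apply: Rintegral_eq_pos => t _; rewrite big_nat_recr.
Qed.

Variables alpha theta : R.
Let psi := pi / 2 * alpha * theta.
Hypotheses (a0 : 0 < alpha) (a2 : alpha <= 2) (psi_lt : `|psi| < pi / 2).

Let e t := expR (- (t `^ alpha * cos psi)).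

(** The exponential is the modulus of the characteristic function, so these are its absolute moments
    on the half-line. *)
Definition cdf_remainder N := \int[mu]_(t in `]0, +oo[)
  (t ^+ N * expR (- (t `^ alpha * cos psi))).

Lemma integrable_remainder N : mu.-integrable `]0, +oo[ (EFin \o (fun t => t ^+ N * e t)).
Proof.
have n0 : 0 < N.+1%:R :> R by [].
apply: integrable_eq_pos (integrable_powR_expR n0 a0 (cos_arg_gt0 psi_lt)) => t t0.
by rewrite -natr1 addrK powR_mulrn ?(ltW t0)// /e (mulrC (cos psi)).
Qed.

(** The case [q = n + 1] of [Rintegral_powR_expR_cos]; the last [- pi / 2] in [kap] turns the cosine
    into the sine. *)
Lemma moment_sin n :
  \int[mu]_(t in `]0, +oo[) (t ^+ n * (e t * sin (t `^ alpha * sin psi - n.+1%:R * (pi / 2)))) =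
  - (Gamma (n.+1%:R / alpha) / alpha * sin (pi / 2 * n.+1%:R * (1 - theta))).
Proof.
have n0 : 0 < n.+1%:R :> R by [].
have := Rintegral_powR_expR_cos (- (n.+1%:R * (pi / 2)) - pi / 2) ltr01 a0 n0 psi_lt.
rewrite (Gamma_powR_expR n0 a0 ltr01) powR1 mulr1 (mulrC alpha) mulfK ?gt_eqF//.
have -> : n.+1%:R * (psi / alpha) + (- (n.+1%:R * (pi / 2)) - pi / 2) =
    - (pi / 2 * n.+1%:R * (1 - theta)) - pi / 2.
  rewrite /psi; move: (@pi R) => p; field; by rewrite gt_eqF.
rewrite cosBpihalf sinN mulNr [sin _ * _]mulrC => <-.
apply: Rintegral_eq_pos => t t0.
rewrite -natr1 addrK powR_mulrn ?(ltW t0)// /e !mul1r; congr (_ * (_ * _)).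
by rewrite addrAC cosBpihalf addrC.
Qed.

(** The sine in [gil_pelaez (- x)] is expanded in powers of [x * t] under the integral; the
    remainder of [sin_taylor] of order [N + 1], divided by [t], leaves [t ^ N]. *)
Lemma cdf_expansion x N :
  `|stable_cdf alpha theta x - ((1 - theta) / 2 + stable_series alpha theta x N)| <=
  `|x| ^+ N.+1 / N.+1`!%:R * cdf_remainder N / pi.
Proof.
have mI : measurable (`]0, +oo[%classic : set (measurableTypeR R)) by exact: measurable_itv.
have pi0 : 0 < pi :> R by exact: pi_gt0.
(* The Taylor term of degree [k] in [x] of the integrand of [gil_pelaez (- x)]. *)
pose h k t := t^-1 * (e t * ((x * t) ^+ k / k`!%:R * sin (t `^ alpha * sin psi - k%:R * (pi / 2)))).
have hS k (t : R) : 0 < t -> h k.+1 t = x ^+ k.+1 / k.+1`!%:R *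
    (t ^+ k * (e t * sin (t `^ alpha * sin psi - k.+1%:R * (pi / 2)))).
  move=> t0; rewrite /h exprMn [t ^+ k.+1]exprS.
  move: (sin _) (k.+1`!%:R^-1) (x ^+ k.+1) (t ^+ k) => s F X T.
  by field; rewrite gt_eqF.
have h0 t : h 0%N t = t^-1 * (e t * sin (0 * t + t `^ alpha * sin psi)).
  by rewrite /h expr0 fact0 divr1 mul1r mul0r subr0 mul0r add0r.
have intm k : mu.-integrable `]0, +oo[ (EFin \o (fun t =>
    t ^+ k * (e t * sin (t `^ alpha * sin psi - k.+1%:R * (pi / 2))))).
  apply: (integrable_pos_dominated _ _ (integrable_remainder k)).
    move=> t t0; apply: continuousM; first exact: exprn_continuous.
    by apply: has_derive_continuous; rewrite /e; der.
  move=> t t0; rewrite normrM ger0_norm ?exprn_ge0 ?(ltW t0)// ler_pM2l ?exprn_gt0//.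
  by rewrite normrM ger0_norm ?expR_ge0// ler_piMr ?expR_ge0// sin_max.
have inth k : mu.-integrable `]0, +oo[ (EFin \o h k).
  case: k => [|k].
    by apply: integrable_eq_pos (integrable_gil_pelaez a0 psi_lt 0) => t _; rewrite h0.
  apply: integrable_eq_pos (integrable_scale (x ^+ k.+1 / k.+1`!%:R) mI (intm k)) => t t0.
  by rewrite hS.
have [intsum sumE] := Rintegral_sum N.+1 inth.
(* The term of degree 0 is [gil_pelaez 0] and gives the constant [(1 - theta) / 2]; hence [N + 1]
   Taylor terms match [N] terms of the series. *)
have sumhE : \sum_(0 <= k < N.+1) \int[mu]_(t in `]0, +oo[) h k t =
    pi / 2 * theta - pi * stable_series alpha theta x N.
  rewrite big_nat_recl//; congr (_ + _).
    rewrite (@Rintegral_eq_pos _ _ _ (fun t _ => h0 t)) -/(gil_pelaez _ _ _).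
    rewrite gil_pelaez0// /psi; move: (@pi R) => p; field.
    by rewrite gt_eqF.
  rewrite /stable_series mulrA mulr_sumr -sumrN; apply: eq_bigr => k _.
  rewrite (@Rintegral_eq_pos _ _ _ (hS k)) RintegralZl// moment_sin.
  move: (Gamma _) (sin _) => G s; move: (@pi R) pi0 => p p0.
  by field; rewrite pnatr_eq0 -?lt0n fact_gt0 !gt_eqF.
have gpE := integrable_gil_pelaez a0 psi_lt (- x).
rewrite stable_cdfE//.
have -> : 1 / 2 - gil_pelaez alpha psi (- x) / pi -
    ((1 - theta) / 2 + stable_series alpha theta x N) =
    - (gil_pelaez alpha psi (- x) - \sum_(0 <= k < N.+1) \int[mu]_(t in `]0, +oo[) h k t) / pi.
  rewrite sumhE; move: (gil_pelaez _ _ _) (stable_series _ _ _ _) => g s.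
  by move: (@pi R) pi0 => p p0; field; rewrite gt_eqF.
rewrite mulNr normrN normrM [X in _ * X]gtr0_norm ?invr_gt0// ler_pM2r ?invr_gt0//.
rewrite -sumE -RintegralB//.
rewrite /cdf_remainder -RintegralZl//; last exact: integrable_remainder.
apply: norm_Rintegral_pos_le.
- exact: integrable_sub.
- by apply: integrable_scale => //; exact: integrable_remainder.
move=> t t0; rewrite -/(e t).
have -> : \sum_(0 <= k < N.+1) h k t = t^-1 * (e t * \sum_(0 <= k < N.+1)
    ((x * t) ^+ k / k`!%:R * sin (t `^ alpha * sin psi - k%:R * (pi / 2)))).
  by rewrite !mulr_sumr.
rewrite -!mulrBr normrM ger0_norm ?invr_ge0 ?(ltW t0)//.
rewrite normrM ger0_norm ?expR_ge0//.
rewrite (_ : - x * t + t `^ alpha * sin psi = t `^ alpha * sin psi - x * t); last ring.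
have -> : `|x| ^+ N.+1 / N.+1`!%:R * (t ^+ N * e t) = t^-1 * (e t * (`|x * t| ^+ N.+1 / N.+1`!%:R)).
  rewrite normrM (gtr0_norm t0) exprMn [t ^+ N.+1]exprS.
  move: (N.+1`!%:R^-1) (`|x| ^+ N.+1) (t ^+ N) => F X T.
  by field; rewrite gt_eqF.
by rewrite ler_pM2l ?invr_gt0// ler_pM2l ?expR_gt0// sin_taylor.
Qed.

Lemma cdf_remainder_ge0 N : 0 <= cdf_remainder N.
Proof.
apply: Rintegral_ge0 => t /=; rewrite in_itv/= andbT => t0.
by rewrite mulr_ge0 ?expR_ge0// exprn_ge0// ltW.
Qed.

End cdf_expansion.

(** * The three regimes *)

Section convergence.
Context {R : realType}.
Local Notation mu := (@lebesgue_measure R).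
Implicit Types alpha theta x : R.

(** The last bound amounts to [alpha * |theta| < 1]. It follows from [|theta| <= 1] for [alpha < 1],
    and from [alpha * |theta| <= 2 - alpha] for [1 < alpha]. *)
Lemma admissible_arg alpha theta : admissible alpha theta ->
  (alpha = 1 -> `|theta| < 1) ->
  [/\ 0 < alpha, alpha <= 2 & `|pi / 2 * alpha * theta| < pi / 2].
Proof.
move=> [/andP[a0 a2]]; rewrite le_min => /andP[th1 th2] h1; split=> //.
have pi0 : 0 < pi / 2 :> R by rewrite divr_gt0// pi_gt0.
rewrite -mulrA normrM (gtr0_norm pi0) gtr_pMr// normrM (gtr0_norm a0).
have th3 : alpha * `|theta| <= 2 - alpha.
  have -> : 2 - alpha = alpha * (2 / alpha - 1) by field; rewrite gt_eqF.
  by rewrite ler_pM2l.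
have [a1|a1|a1] := ltgtP alpha 1; last by rewrite a1 mul1r h1.
  by rewrite (le_lt_trans _ a1)// ler_piMr// ltW.
by rewrite (le_lt_trans th3)// ltrBlDr (_ : 2 = 1 + 1 :> R)// ltrD2l.
Qed.

Lemma cvg_error_bound (u b : R^nat) (l : R) : (forall n, `|l - u n| <= b n) ->
  b n @[n --> \oo] --> 0 -> u n @[n --> \oo] --> l.
Proof.
move=> ub b0; apply/cvgrPdist_le => e e0; near=> n.
rewrite (le_trans (ub n))//; near: n.
exact: cvgr_le b0 _ e0.
Unshelve. all: by end_near. Qed.

Lemma stable_series_shift alpha theta x (l : R) :
  (fun N => (1 - theta) / 2 + stable_series alpha theta x N) @ \oo --> l ->
  cvgn (stable_series alpha theta x).
Proof.
move=> cv; apply/cvg_ex; exists (- ((1 - theta) / 2) + l).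
rewrite (_ : stable_series alpha theta x = fun N =>
    - ((1 - theta) / 2) + ((1 - theta) / 2 + stable_series alpha theta x N)).
  by apply: cvgD => //; exact: cvg_cst.
by apply/funext => N; rewrite addKr.
Qed.

(** The bound of [cdf_expansion] has a factor independent of [x], which serves as the constant of
    the Landau symbol. *)
Lemma asymptotic_expansion alpha theta N : admissible alpha theta -> alpha < 1 ->
  (fun x : R => stable_cdf alpha theta x : R^o) =
  (fun x : R => (1 - theta) / 2 + stable_series alpha theta x N : R^o)
    +O_ (0 : R) (fun x : R => x ^+ N.+1 : R^o).
Proof.
move=> adm a1; have [|a0 a2 psi_lt] := admissible_arg adm.
  by move=> ae; move: a1; rewrite ae ltxx.
apply/eqaddOP; near=> k; apply: nearW => x /=.
rewrite (le_trans (cdf_expansion a0 a2 psi_lt x N))// normrX -!mulrA mulrC.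
rewrite ler_wpM2r ?exprn_ge0//; by near: k; apply: nbhs_pinfty_ge; rewrite num_real.
Unshelve. all: by end_near. Qed.

Lemma expn_div_fact_le_expR (y : R) n : 0 <= y -> y ^+ n / n`!%:R <= expR y.
Proof.
move=> y0; case: n => [|n]; first by rewrite expr0 fact0 divr1 -expR0 ler_expR.
by rewrite (le_trans _ (expR_ge1Dxn n y0))// lerDr.
Qed.

(** Writing [|x| * t] as half of [y * t] splits off a factor [2 ^ (- N)]. The rest is at most
    [exp (y * t)], which the damping of order [alpha > 1] absorbs, so the error is geometric in
    [N]. *)
Lemma cdf_series_cvg alpha theta x : admissible alpha theta -> 1 < alpha ->
  (1 - theta) / 2 + stable_series alpha theta x N @[N --> \oo]
    --> stable_cdf alpha theta x.
Proof.
move=> adm a1; have [|a0 a2 psi_lt] := admissible_arg adm.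
  by move=> ae; move: a1; rewrite ae ltxx.
apply: cvg_error_bound (cdf_expansion a0 a2 psi_lt x) _.
set psi := pi / 2 * alpha * theta; set c := cos psi.
have c0 : 0 < c by exact: cos_arg_gt0.
have pi0 : 0 < pi :> R by exact: pi_gt0.
pose y := 2 * `|x|; have y0 : 0 <= y by rewrite mulr_ge0.
(* [T] solves [c * t ^ (alpha - 1) = y + 1]: beyond it the damping exceeds [(y + 1) * t], before it
   [(y + 1) * t] is at most [(y + 1) * T]. *)
pose T := ((y + 1) / c) `^ (alpha - 1)^-1.
have am1 : 0 < alpha - 1 by rewrite subr_gt0.
have exponent_le (t : R) : 0 < t -> y * t - t `^ alpha * c <= (y + 1) * T - t.
  move=> t0; have y1 : 0 < y + 1 by rewrite ltr_wpDl.
  have tac : 0 <= t `^ alpha * c by rewrite mulr_ge0 ?powR_ge0// ltW.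
  have [tT|/ltW Tt] := leP t T.
    have : (y + 1) * t <= (y + 1) * T by rewrite ler_pM2l.
    rewrite mulrDl mul1r; move: ((y + 1) * T) => z; lra.
  have := ge0_ler_powR (ltW am1) _ _ Tt; rewrite !nnegrE powR_ge0 (ltW t0) => /(_ isT isT).
  rewrite -powRrM mulVf ?gt_eqF// powRr1 ?divr_ge0 ?(ltW y1) ?(ltW c0)// ler_pdivrMr//.
  move=> /(ler_wpM2r (ltW t0)).
  have -> : t `^ (alpha - 1) * c * t = t `^ alpha * c.
    by rewrite powRB ?(gt_eqF t0) ?implybT// powRr1 ?(ltW t0)//; field; rewrite gt_eqF.
  have : 0 <= (y + 1) * T by rewrite mulr_ge0 ?powR_ge0// ltW.
  by rewrite mulrDl mul1r; move: ((y + 1) * T) => z; lra.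
pose C := `|x| * expR ((y + 1) * T) / pi.
apply: (@squeeze_cvgr _ _ _ _ (fun=> 0) (geometric C 2^-1)); first last.
- by apply: cvg_geometric; rewrite ger0_norm ?invr_ge0// invf_lt1// ltr1n.
- exact: cvg_cst.
apply: nearW => N; apply/andP; split.
  by rewrite !mulr_ge0 ?invr_ge0 ?exprn_ge0 ?cdf_remainder_ge0// ltW.
rewrite /geometric/= /C [leRHS]mulrAC ler_pM2r ?invr_gt0//.
rewrite /cdf_remainder -RintegralZl//; last exact: integrable_remainder.
have int1 := integrable_Gamma (@ltr01 R).
have mI : measurable (`]0, +oo[%classic : set (measurableTypeR R)) by exact: measurable_itv.
have -> : `|x| * expR ((y + 1) * T) * 2^-1 ^+ N = \int[mu]_(t in `]0, +oo[)
    (`|x| * expR ((y + 1) * T) * 2^-1 ^+ N * (t `^ (1 - 1) * expR (- t))).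
  by rewrite RintegralZl// -/(Gamma 1) Gamma1 mulr1.
apply: le_Rintegral_pos.
- by apply: integrable_scale => //; exact: integrable_remainder.
- exact: integrable_scale.
move=> t t0; rewrite -/psi -/c subrr powRr0 mul1r.
have yt0 : 0 <= y * t by rewrite mulr_ge0// ltW.
have h1 : expR (y * t) * expR (- (t `^ alpha * c)) <= expR ((y + 1) * T) * expR (- t).
  by rewrite -!expRD ler_expR exponent_le.
have h2 := expn_div_fact_le_expR N yt0.
have h3 : (N.+1)`!%:R^-1 <= N`!%:R^-1 :> R.
  by rewrite lef_pV2 ?posrE ?ltr0n ?fact_gt0// ler_nat factS leq_pmull.
have E0 := expR_ge0 (- (t `^ alpha * c)).
set E := expR (- (t `^ alpha * c)) in h1 E0 *.
have -> : `|x| ^+ N.+1 / (N.+1)`!%:R * (t ^+ N * E) =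
    (`|x| * 2^-1 ^+ N) * (((y * t) ^+ N / (N.+1)`!%:R) * E).
  rewrite /y !exprMn exprS exprVn; move: (_`!%:R^-1) (`|x| ^+ N) (t ^+ N) => F X T'.
  by field; rewrite expf_neq0// pnatr_eq0.
have -> : `|x| * expR ((y + 1) * T) * 2^-1 ^+ N * expR (- t) =
    (`|x| * 2^-1 ^+ N) * (expR ((y + 1) * T) * expR (- t)) by ring.
apply: ler_wpM2l; first by rewrite mulr_ge0// exprn_ge0// invr_ge0.
rewrite (le_trans _ h1)// ler_wpM2r// (le_trans _ h2)// ler_wpM2l// exprn_ge0//.
Qed.

(** [pi] times a Cauchy density, from the elementary primitive [F] of
    [exp (- t * c) * cos (b * t)]. *)
Lemma fourier_cos1 psi Y : `|psi| < pi / 2 ->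
  fourier_cos 1 psi Y = cos psi / (cos psi ^+ 2 + (Y + sin psi) ^+ 2) :> R.
Proof.
move=> psi_lt; set c := cos psi; set b := Y + sin psi.
have c0 : 0 < c by exact: cos_arg_gt0.
have d0 : 0 < c ^+ 2 + b ^+ 2 by rewrite ltr_wpDr ?sqr_ge0// exprn_gt0.
pose F t := expR (- (t * c)) * (b * sin (b * t) - c * cos (b * t)) / (c ^+ 2 + b ^+ 2).
have -> : fourier_cos 1 psi Y = \int[mu]_(t in `]0, +oo[) (expR (- (t * c)) * cos (b * t)).
  by apply: Rintegral_eq_pos => t t0; rewrite powRr1 ?(ltW t0)// /b mulrDl (mulrC t (sin _)).
rewrite (@Rintegral_pos_FTC _ _ F (- (c / (c ^+ 2 + b ^+ 2))) 0).
- by rewrite sub0r opprK.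
- by move=> t t0; apply: has_derive_continuous; der.
- move=> t t0; apply: has_derive_eq; first by rewrite /F; der.
  move=> /=; move: (sin (b * t)) (cos (b * t)) (expR (- (t * c))) => s k e.
  by field; rewrite gt_eqF.
- apply: integrable_eq_pos (integrable_fourier_cos ltr01 psi_lt Y) => t t0.
  by rewrite powRr1 ?(ltW t0)// /b mulrDl (mulrC t (sin _)).
- have F0 : F 0 = - (c / (c ^+ 2 + b ^+ 2)).
    by rewrite /F mul0r oppr0 expR0 mulr0 sin0 cos0; field; rewrite gt_eqF.
  rewrite -F0; apply: cvg_at_right_filter.
  suff : {for 0, continuous F} by [].
  by apply: has_derive_continuous; rewrite /F; der.
- apply/cvgr0Pnorm_le => eps eps0; near=> t.
  have t0 : 0 < t by near: t; exact: nbhs_pinfty_gt.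
  have Kt : (`|b| + c) / (c ^+ 2 + b ^+ 2) / c / eps <= t.
    by near: t; apply: nbhs_pinfty_ge; rewrite num_real.
  have tc : 0 < t * c by rewrite mulr_gt0.
  have le1 : expR (- (t * c)) <= (t * c)^-1.
    by rewrite expRN lef_pV2 ?posrE ?expR_gt0// (le_trans _ (expR_ge1Dx _))// lerDr.
  have le2 : `|b * sin (b * t) - c * cos (b * t)| <= `|b| + c.
    rewrite (le_trans (ler_normB _ _))// lerD// normrM.
      by rewrite ler_piMr// sin_max.
    by rewrite (gtr0_norm c0) ler_piMr ?cos_max// ltW.
  rewrite /F normrM (gtr0_norm (x := _^-1)) ?invr_gt0// normrM (ger0_norm (expR_ge0 _)).
  rewrite (@le_trans _ _ ((t * c)^-1 * (`|b| + c) / (c ^+ 2 + b ^+ 2)))//.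
    by rewrite ler_pM2r ?invr_gt0// ler_pM ?expR_ge0.
  move: Kt; rewrite ler_pdivrMr// => Kt.
  rewrite (_ : _ / _ = (`|b| + c) / (c ^+ 2 + b ^+ 2) / c / t); last first.
    by move: `|b| => bb; field; rewrite !gt_eqF.
  by rewrite ler_pdivrMr// [eps * t]mulrC.
Unshelve. all: by end_near. Qed.

(** Imaginary part of a finite geometric sum of ratio [y * exp (i * beta)], cleared of the
    denominator [|1 - y * exp (i * beta)| ^ 2]. *)
Lemma sin_geometric_sum (beta y : R) N :
  sin beta - (1 - 2 * y * cos beta + y ^+ 2) * \sum_(0 <= n < N) y ^+ n * sin (n.+1%:R * beta) =
  y ^+ N * sin (N.+1%:R * beta) - y ^+ N.+1 * sin (N%:R * beta).
Proof.
elim: N => [|N IHN].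
  by rewrite big_geq// mulr0 subr0 expr0 !mul1r mul0r sin0 mulr0 subr0.
rewrite big_nat_recr//= mulrDr opprD addrA IHN.
have -> : sin (N.+2%:R * beta) = 2 * cos beta * sin (N.+1%:R * beta) - sin (N%:R * beta).
  rewrite (_ : N.+2%:R * beta = N.+1%:R * beta + beta); last by rewrite -natr1; ring.
  rewrite (_ : N%:R * beta = N.+1%:R * beta - beta); last by rewrite -natr1; ring.
  by rewrite sinD sinB; ring.
rewrite !exprS; ring.
Qed.

(** [G] and the polynomial [P N] agree at 0, and their derivatives differ by the remainder of a
    geometric sum, so a Lipschitz bound on [[- |x|, |x|]] suffices. *)
Lemma cdf_series_cvg1 theta x : `|theta| < 1 -> `|x| < 1 ->
  (1 - theta) / 2 + 1 / pi * \sum_(0 <= n < N)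
     x ^+ n.+1 / n.+1%:R * sin (pi / 2 * n.+1%:R * (1 - theta)) @[N --> \oo]
  --> stable_cdf 1 theta x.
Proof.
move=> th1 x1; have pi0 : 0 < pi :> R by exact: pi_gt0.
set psi := pi / 2 * 1 * theta.
have psi_lt : `|psi| < pi / 2.
  by rewrite /psi mulr1 normrM gtr0_norm ?gtr_pMr// divr_gt0.
(* [beta] is [pi / 2 - psi], which makes the denominator of the geometric sum that of the Cauchy
   density. *)
pose beta := pi / 2 * (1 - theta).
have sinb : sin beta = cos psi.
  by rewrite /beta mulrBr mulr1 /psi mulr1 -cosBpihalf addrAC subrr sub0r cosN.
have cosb : cos beta = sin psi.
  by rewrite /beta mulrBr mulr1 /psi mulr1 -opprB cosN cosBpihalf.
have c0 : 0 < cos psi by exact: cos_arg_gt0.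
pose P N (y : R) := (1 - theta) / 2 + 1 / pi * \sum_(0 <= n < N)
     y ^+ n.+1 / n.+1%:R * sin (pi / 2 * n.+1%:R * (1 - theta)).
pose dP N (y : R) := 1 / pi * \sum_(0 <= n < N) y ^+ n * sin (n.+1%:R * beta).
have P_der N y : has_derive (P N) y (dP N y).
  apply: has_derive_eq.
    refine (@has_deriveD _ _ _ _ _ _ (has_derive_cst _ _) _).
    refine (@has_deriveM _ _ _ _ _ _ (has_derive_cst _ _) _).
    have : has_derive (fun y => \sum_(0 <= n < N)
        y ^+ n.+1 / n.+1%:R * sin (pi / 2 * n.+1%:R * (1 - theta))) y
        (\sum_(0 <= n < N) y ^+ n * sin (n.+1%:R * beta)); last by apply.
    elim: N => [|N IHN].
      by rewrite big_geq//; under eq_fun do rewrite big_geq//; exact: has_derive_cst.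
    rewrite big_nat_recr//=; under eq_fun do rewrite big_nat_recr//=.
    apply: has_derive_eq; first by refine (@has_deriveD _ _ _ _ _ _ IHN _); der.
    congr (_ + _).
    rewrite (_ : pi / 2 * N.+1%:R * (1 - theta) = N.+1%:R * beta); last by rewrite /beta; ring.
    by move: (sin _) => s /=; field; rewrite nat1r pnatr_eq0.
  by rewrite mulr0 addr0 add0r.
pose G y : R := stable_cdf 1 theta y.
have GE : G = fun y => 1 / 2 - gil_pelaez 1 psi (- y) / pi.
  by apply/funext => y; rewrite /G stable_cdfE// ler1n.
have G_der y : has_derive G y (fourier_cos 1 psi (- y) / pi).
  rewrite GE.
  apply: has_derive_eq.
    refine (@has_deriveD _ _ _ _ _ _ (has_derive_cst _ _) _).
    refine (@has_deriveN _ _ _ _ _).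
    refine (@has_deriveM _ _ _ _ _ _ _ (has_derive_cst _ _)).
    apply: (@has_derive_comp _ (gil_pelaez 1 psi)).
      exact: has_derive_gil_pelaez.
    exact: has_deriveN (has_derive_id y).
  by rewrite mulr0 add0r add0r; ring.
have P0 N : P N 0 = G 0.
  rewrite /P GE oppr0 gil_pelaez0// big1 ?mulr0 ?addr0; last first.
    by move=> n _; rewrite exprS !mul0r.
  by rewrite /psi; move: (@pi R) pi0 => p p0; field; rewrite gt_eqF.
(* The remainder has two terms of size at most [|x| ^ N], and the denominator is at least
   [cos psi ^ 2]. *)
pose M N := 2 * `|x| ^+ N / (pi * cos psi ^+ 2).
have err N : `|G x - P N x| <= M N.
  have := @has_derive_lipschitz R (fun y => G y - P N y)
    (fun y => fourier_cos 1 psi (- y) / pi - dP N y) (- `|x|) `|x| (M N) 0 x.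
  rewrite P0 subrr !subr0 => /(_ _ _ _ _)/le_trans; apply.
  - move=> y _; refine (@has_deriveD _ _ _ _ _ _ (G_der y) _).
    exact: has_deriveN (P_der N y).
  - move=> y; rewrite in_itv/= -ler_norml => yx.
    rewrite fourier_cos1// /dP.
    have d0 : 0 < cos psi ^+ 2 + (- y + sin psi) ^+ 2.
      by rewrite ltr_wpDr ?sqr_ge0// exprn_gt0.
    have dE : 1 - 2 * y * cos beta + y ^+ 2 = cos psi ^+ 2 + (- y + sin psi) ^+ 2.
      by rewrite cosb -[X in X - _](cos2Dsin2 psi); ring.
    have := sin_geometric_sum beta y N; rewrite dE sinb.
    set S := \sum_(0 <= n < N) _ => SE.
    rewrite (_ : _ - _ = (cos psi - (cos psi ^+ 2 + (- y + sin psi) ^+ 2) * S) /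
        (cos psi ^+ 2 + (- y + sin psi) ^+ 2) / pi); last first.
      move: (cos psi ^+ 2 + _) d0 => d d0; move: (@pi R) pi0 => p p0.
      by field; rewrite !gt_eqF.
    rewrite SE !normrM !(gtr0_norm (x := _^-1)) ?invr_gt0//.
    rewrite (_ : M N = 2 * `|x| ^+ N / cos psi ^+ 2 / pi); last first.
      by rewrite /M invfM mulrA mulrAC.
    rewrite ler_pM2r ?invr_gt0//.
    rewrite ler_pM ?invr_ge0 ?(ltW d0)//; last first.
      by rewrite lef_pV2 ?posrE ?exprn_gt0// lerDl sqr_ge0.
    rewrite (le_trans (ler_normB _ _))// mulr2n mulrDl mul1r !normrM !normrX lerD//.
      rewrite (le_trans (ler_piMr _ (sin_max _))) ?exprn_ge0//.
      by rewrite lerXn2r ?nnegrE.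
    rewrite (le_trans (ler_piMr _ (sin_max _))) ?exprn_ge0//.
    rewrite exprS (le_trans (ler_piMl _ _)) ?exprn_ge0//.
      by rewrite (le_trans yx)// ltW.
    by rewrite lerXn2r ?nnegrE.
  - by rewrite in_itv/= oppr_le0 !normr_ge0.
  - by rewrite in_itv/= -ler_norml.
  - rewrite ler_piMr ?(ltW x1)// /M mulr_ge0 ?invr_ge0// ?mulr_ge0 ?exprn_ge0// ltW//.
apply: cvg_error_bound err _.
rewrite /M (_ : (fun N => _) = geometric (2 / (pi * cos psi ^+ 2)) `|x|).
  by apply: cvg_geometric; rewrite normr_id.
by apply/funext => N /=; rewrite mulrAC.
Qed.

Lemma stable_series1 theta x N : stable_series 1 theta x N =
  1 / pi * \sum_(0 <= n < N) x ^+ n.+1 / n.+1%:R * sin (pi / 2 * n.+1%:R * (1 - theta)).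
Proof.
rewrite /stable_series mulr1; congr (_ * _); apply: eq_bigr => n _.
rewrite divr1 Gamma_nat factS natrM; congr (_ * _).
have nf0 : n`!%:R != 0 :> R by rewrite pnatr_eq0 -lt0n fact_gt0.
by move: (n`!%:R) nf0 => F F0; field; rewrite F0 nat1r pnatr_eq0.
Qed.

(** Comparison with a geometric series, which includes [theta = 1] and [theta = - 1]. *)
Lemma stable_series1_cvg theta x : `|x| < 1 -> cvgn (stable_series 1 theta x).
Proof.
move=> x1.
pose u n := x ^+ n.+1 / n.+1%:R * sin (pi / 2 * n.+1%:R * (1 - theta)).
rewrite (_ : stable_series 1 theta x = fun N => 1 / pi * series u N); last first.
  by apply/funext => N; exact: stable_series1.
apply: is_cvgM; first exact: is_cvg_cst.
apply: normed_cvg; apply: (@series_le_cvg _ _ (geometric `|x| `|x|)).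
- by move=> n /=.
- by move=> n; rewrite /= mulr_ge0// exprn_ge0.
- move=> n; rewrite /u /= normrM (le_trans (ler_piMr _ (sin_max _)))//.
  rewrite normrM normrX -exprS ler_piMr ?exprn_ge0// ger0_norm ?invr_ge0//.
  by rewrite invf_le1// ler1n.
- by apply: is_cvg_geometric_series; rewrite normr_id.
Qed.

End convergence.

(** * Divergence of the series for exponents below 1 *)

Section divergence.
Context {R : realType}.
Local Notation mu := (@lebesgue_measure R).

(* Pointwise, [t ^ q * (t ^ m - A ^ m) >= A ^ q * (t ^ m - A ^ m)], also for [t < A]. *)
Lemma Gamma_ge (A q : R) m : 0 < A -> 0 <= q ->
  A `^ q * (m`!%:R - A ^+ m) <= Gamma (q + m.+1%:R).
Proof.
move=> A0 q0.
have mI : measurable (`]0, +oo[%classic : set (measurableTypeR R)) by exact: measurable_itv.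
have m0 : 0 < m.+1%:R :> R by [].
have qm0 : 0 < q + m.+1%:R by rewrite ltr_wpDl.
have int1 := integrable_Gamma (@ltr01 R).
have intm := integrable_Gamma m0.
have intB := integrable_sub mI intm (integrable_scale (A ^+ m) mI int1).
have -> : A `^ q * (m`!%:R - A ^+ m) = \int[mu]_(t in `]0, +oo[) (A `^ q *
    (t `^ (m.+1%:R - 1) * expR (- t) - A ^+ m * (t `^ (1 - 1) * expR (- t)))).
  rewrite RintegralZl// RintegralB//; last exact: integrable_scale.
  by rewrite RintegralZl// -/(Gamma 1) -/(Gamma m.+1%:R) Gamma1 Gamma_nat mulr1.
apply: le_Rintegral_pos; [exact: integrable_scale|exact: integrable_Gamma|].
move=> t t0; rewrite subrr powRr0 mul1r -natr1 addrK powR_mulrn ?(ltW t0)//.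
have -> : q + (m%:R + 1) - 1 = q + m%:R by ring.
rewrite powRD ?(gt_eqF t0) ?implybT// powR_mulrn ?(ltW t0)//.
rewrite -mulrBl mulrA ler_wpM2r ?expR_ge0//.
have [At|tA] := leP A t.
  rewrite ler_pM ?powR_ge0// ?subr_ge0 ?lerXn2r ?nnegrE ?(ltW A0) ?(ltW t0)//.
    by rewrite ge0_ler_powR ?nnegrE ?(ltW A0) ?(ltW t0).
  by rewrite gerBl exprn_ge0// ltW.
rewrite (@le_trans _ _ 0)//; last by rewrite mulr_ge0 ?powR_ge0 ?exprn_ge0// ltW.
rewrite mulr_ge0_le0 ?powR_ge0// subr_le0 lerXn2r ?nnegrE ?(ltW A0) ?(ltW t0)//.
exact: ltW.
Qed.

(** [beta] is the difference of two consecutive multiples, so [|sin beta|] is at most the sum of the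
    absolute values of their sines. *)
Lemma sin_multiples_cvg0 (beta : R) :
  sin (n.+1%:R * beta) @[n --> \oo] --> 0 -> sin beta = 0.
Proof.
move=> cv; apply/eqP; rewrite -normr_le0.
have cvn : `|sin (n.+1%:R * beta)| @[n --> \oo] --> (0 : R) by rewrite -(normr0 R); exact: cvg_norm.
have cvs : `|sin (n.+2%:R * beta)| @[n --> \oo] --> (0 : R).
  by move: cvn => /(cvg_comp (addn 1) _ (cvg_addnl 1)).
have cvD : `|sin (n.+2%:R * beta)| + `|sin (n.+1%:R * beta)| @[n --> \oo] --> (0 : R).
  by rewrite -(addr0 0); exact: cvgD.
apply: (@cvgr_to_ge _ _ _ _ _ _ _ cvD) => //; apply: nearW => n.
rewrite (_ : sin beta = sin (n.+2%:R * beta - n.+1%:R * beta)); last first.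
  by rewrite -mulrBl -[n.+2%:R]natr1 addrC addKr mul1r.
rewrite sinB (le_trans (ler_normB _ _))// lerD//.
  by rewrite normrM ler_piMr// cos_max.
by rewrite normrM ler_piMl// cos_max.
Qed.

(** Convergence would send the terms to 0. The coefficients without the sine are eventually at least
    [1 / (2 * A)], so the sines would tend to 0 and [sin beta = 0], against [0 < beta < pi]. *)
Lemma stable_series_dvg (alpha theta x : R) : 0 < alpha -> alpha < 1 -> `|theta| < 1 ->
  x != 0 -> ~ cvgn (stable_series alpha theta x).
Proof.
move=> a0 a1 th1 x0 cvS.
have pi0 : 0 < pi :> R by exact: pi_gt0.
pose beta := pi / 2 * (1 - theta).
pose a n := x ^+ n.+1 / (n.+1)`!%:R * Gamma (n.+1%:R / alpha) * sin (pi / 2 * n.+1%:R * (1 - theta)).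
have pia0 : pi * alpha != 0 by rewrite gt_eqF// mulr_gt0.
have cva : a n @[n --> \oo] --> 0.
  apply: cvg_series_cvg_0.
  rewrite (_ : series a = fun N => (pi * alpha) * stable_series alpha theta x N).
    by apply: is_cvgM => //; exact: is_cvg_cst.
  by apply/funext => N; rewrite /stable_series mulrA div1r mulfV// mul1r.
pose d := alpha^-1 - 1.
have d0 : 0 < d by rewrite subr_gt0 invf_gt1.
have nx0 : 0 < `|x| by rewrite normr_gt0.
(* Chosen so that [A ^ (m * d) = |x| ^ (- m)], which cancels the power of [x] in the coefficient. *)
pose A := `|x|^-1 `^ d^-1.
have A0 : 0 < A by rewrite powR_gt0 ?invr_gt0.
have Ad m : A `^ (m%:R * d) = `|x| ^- m.
  rewrite /A -powRrM mulrCA mulVf ?gt_eqF// mulr1 powR_mulrn ?invr_ge0// exprVn //.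
(* As [m / alpha = (m * d - 1) + (m + 1)], [Gamma_ge] applies with [q = m * d - 1] and leaves
   [(1 - A ^ m / m!) / A]. *)
have coef m : 1 <= m%:R * d -> A ^+ m / m`!%:R <= 2^-1 ->
    (2 * A)^-1 <= `|x| ^+ m / m`!%:R * Gamma (m%:R / alpha).
  move=> md Am; have f0 : 0 < m`!%:R :> R by rewrite ltr0n fact_gt0.
  have q0 : 0 <= m%:R * d - 1 by rewrite subr_ge0.
  have := Gamma_ge m A0 q0.
  have -> : m%:R * d - 1 + m.+1%:R = m%:R / alpha by rewrite /d -natr1; ring.
  rewrite powRB ?(gt_eqF A0) ?implybT// powRr1 ?(ltW A0)// Ad => hG.
  have xm0 : 0 < `|x| ^+ m / m`!%:R by rewrite divr_gt0// exprn_gt0.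
  rewrite (le_trans _ (ler_wpM2l (ltW xm0) hG))//.
  rewrite [leRHS](_ : _ = A^-1 * (1 - A ^+ m / m`!%:R)); last first.
    have := exprn_gt0 m nx0; move: (m`!%:R) f0 (`|x| ^+ m) (A ^+ m) => f f0 y Am' y0.
    by field; rewrite !gt_eqF.
  by rewrite invfM mulrC ler_pM2l ?invr_gt0//; lra.
have Afact : A ^+ m / m`!%:R @[m --> \oo] --> 0.
  exact: (cvg_series_cvg_0 (is_cvg_series_exp_coeff A)).
have sin_le : \forall n \near \oo, `|sin (n.+1%:R * beta)| <= 2 * A * `|a n|.
  have md : \forall n \near \oo, 1 <= n.+1%:R * d.
    near=> n; rewrite -ler_pdivrMr// (@le_trans _ _ n%:R) ?ler_nat//.
    near: n; exact: nbhs_infty_ger.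
  have Am : \forall n \near \oo, A ^+ n.+1 / n.+1`!%:R <= 2^-1.
    apply: (@cvgr_le _ _ _ _ (fun n => A ^+ n.+1 / n.+1`!%:R) 0); last by rewrite invr_gt0.
    exact: (cvg_comp (addn 1) _ (cvg_addnl 1) Afact).
  near=> n; have nd : 1 <= n.+1%:R * d by near: n.
  have An : A ^+ n.+1 / n.+1`!%:R <= 2^-1 by near: n.
  have := coef _ nd An; rewrite /a.
  rewrite (_ : pi / 2 * n.+1%:R * (1 - theta) = n.+1%:R * beta); last by rewrite /beta; ring.
  have G0 : 0 <= Gamma (n.+1%:R / alpha).
    by apply: Rintegral_ge0 => t _; rewrite mulr_ge0 ?powR_ge0 ?expR_ge0.
  rewrite !normrM normrX (ger0_norm G0) (ger0_norm (x := _^-1)) ?invr_ge0//.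
  move=> /(ler_wpM2r (normr_ge0 (sin (n.+1%:R * beta)))).
  rewrite ler_pdivrMl ?mulr_gt0//.
have : sin beta = 0.
  apply: sin_multiples_cvg0; apply: norm_cvg0.
  apply: (@squeeze_cvgr _ _ _ _ (fun=> 0) (fun n => 2 * A * `|a n|)).
  - by near=> n; rewrite normr_ge0/=; near: n.
  - exact: cvg_cst.
  - rewrite -[X in _ --> X](mulr0 (2 * A)); apply: cvgM; first exact: cvg_cst.
    by rewrite -(normr0 R); exact: cvg_norm.
apply/eqP; rewrite gt_eqF// sin_gt0_pi// /beta.
move: th1; rewrite ltr_norml => /andP[h1 h2].
apply/andP; split; first by rewrite mulr_gt0 ?divr_gt0// subr_gt0.
by rewrite mulrAC ltr_pdivrMr// ltr_pM2l//; lra.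
Unshelve. all: by end_near. Qed.

End divergence.

(** The divergence clause leaves out [x = 0] and [theta = 1] or [- 1] because there every term of
    the series is 0. *)
Theorem corollary2 (R : realType) :
  (forall alpha theta : R, admissible alpha theta -> alpha < 1 ->
     (theta != 1 -> theta != -1 -> forall x : R, x != 0 ->
        ~ cvgn (stable_series alpha theta x))
     /\
     (forall N : nat,
        (fun x : R => stable_cdf alpha theta x : R^o) =
        (fun x : R => (1 - theta) / 2 + stable_series alpha theta x N : R^o)
          +O_ (0 : R) (fun x : R => x ^+ N.+1 : R^o)))
  /\
  (forall theta : R, admissible 1 theta ->
     (forall x : R, `|x| < 1 -> cvgn (stable_series 1 theta x))
     /\
     (theta != 1 -> theta != -1 -> forall x : R, `|x| < 1 ->
        (fun N : nat => (1 - theta) / 2 + 1 / pi * \sum_(0 <= n < N)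
           x ^+ n.+1 / n.+1%:R * sin (pi / 2 * n.+1%:R * (1 - theta)))
        @ \oo --> stable_cdf 1 theta x))
  /\
  (forall alpha theta : R, admissible alpha theta -> 1 < alpha ->
     forall x : R,
       cvgn (stable_series alpha theta x)
       /\
       (fun N : nat => (1 - theta) / 2 + stable_series alpha theta x N)
         @ \oo --> stable_cdf alpha theta x).
Proof.
have theta_lt1 (alpha theta : R) : admissible alpha theta -> theta != 1 -> theta != -1 ->
    `|theta| < 1.
  move=> [_]; rewrite le_min => /andP[th _] t1 tN1.
  by rewrite lt_neqAle th andbT eqr_norml negb_and negb_or t1 tN1.
split; [|split].
- move=> alpha theta adm a1; split; last by move=> N; exact: asymptotic_expansion.
  move=> t1 tN1 x x0; have [/andP[a0 _] _] := adm.
  exact: stable_series_dvg a0 a1 (theta_lt1 _ _ adm t1 tN1) x0.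
- move=> theta adm; split; first by move=> x; exact: stable_series1_cvg.
  by move=> t1 tN1 x; apply: cdf_series_cvg1; exact: theta_lt1 adm t1 tN1.
- move=> alpha theta adm a1 x; split; last exact: cdf_series_cvg.
  exact: stable_series_shift (@cdf_series_cvg _ _ _ x adm a1).
Qed.
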